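(* Let $n$ be an odd integer and let $C_n$ be the cycle on $n$ vertices. Then $\widetilde{r}_{ind}(C_n) \le \widetilde{r}_{ind}(C_{2n})+n \le 735n-27$.
   Context: The online Ramsey game for a target graph $H$ is played between Builder and Painter on an infinite set of vertices, initially with no edges. In each round Builder adds a new edge between two vertices (forming the background graph $G$), and Painter immediately colors that edge red or blue. The induced online Ramsey number $\widetilde{r}_{ind}(H)$ is the minimum number $m$ such that Builder has a strategy guaranteeing that, against any Painter strategy, after at most $m$ rounds there is a monochromatic induced copy of $H$ in $G$, i.e. a vertex set $S$ such that the subgraph of $G$ induced on $S$ is isomorphic to $H$ and all its edges have the same color ($\infty$ if no such strategy exists). *)

(* Defs.v *)
From mathcomp Require Export all_boot all_order all_algebra.
From mathcomp Require Export boolp classical_sets functions constructive_ereal.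

Set Implicit Arguments.
Unset Strict Implicit.
Unset Printing Implicit Defensive.

Record sgraph := SGraph {
  vertex :> finType;
  edge : rel vertex;
  edge_sym : symmetric edge;
  edge_irr : irreflexive edge }.

Section Cycle.
Variable n : nat.

(* The conjunct i != j only matters for n = 1; the graph is the cycle on n
   vertices as soon as n >= 3. *)
Definition cycle_edge (i j : 'I_n) : bool :=
  (i != j) && ((j == ordS i) || (i == ordS j)).

Lemma cycle_edge_sym : symmetric cycle_edge.
Proof. by move=> i j; rewrite /cycle_edge eq_sym orbC. Qed.

Lemma cycle_edge_irr : irreflexive cycle_edge.
Proof. by move=> i; rewrite /cycle_edge eqxx. Qed.

Definition cycle_graph : sgraph := SGraph cycle_edge_sym cycle_edge_irr.

End Cycle.

(* The board is the vertex set nat; the unordered pair {u, v} is represented by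
   the pair (u, v) with u < v. A position is the list of the edges drawn so far,
   in order, each with its color (true for red, false for blue). *)
Definition position := seq ((nat * nat) * bool).

Definition pair_of (u v : nat) : nat * nat := (minn u v, maxn u v).

Definition drawn (h : position) (u v : nat) : bool :=
  pair_of u v \in unzip1 h.

Definition colored (h : position) (c : bool) (u v : nat) : bool :=
  (pair_of u v, c) \in h.

Definition new_edge (h : position) (e : nat * nat) : bool :=
  (e.1 < e.2) && ~~ drawn h e.1 e.2.

Definition mono_induced_copy (H : sgraph) (h : position) : Prop :=
  exists (S : set nat) (f : H -> nat) (c : bool),
    [/\ set_bij [set: H]%classic S f,
        forall x y : H, edge x y = drawn h (f x) (f y) &
        forall u v : nat, S u -> S v -> drawn h u v -> colored h c u v].

(* A strategy prescribes a move in every position, reachable or not. This loses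
   no Builder strategy: every position is finite, so a new edge always exists. *)
Definition builder_strategy (b : position -> nat * nat) : Prop :=
  forall h : position, new_edge h (b h).

Fixpoint play (b : position -> nat * nat) (p : position -> nat * nat -> bool)
    (k : nat) : position :=
  if k is k'.+1 then
    let h := play b p k' in rcons h (b h, p h (b h))
  else [::].

Definition builder_wins (H : sgraph) (m : nat) : Prop :=
  exists2 b : position -> nat * nat, builder_strategy b &
    forall p : position -> nat * nat -> bool,
      exists2 k : nat, k <= m & mono_induced_copy H (play b p k).

Definition r_ind (H : sgraph) : \bar int :=
  match pselect (exists m : nat, `[< builder_wins H m >]) with
  | left ex_m => ((ex_minn ex_m)%:Z)%:E
  | right _ => +oo%E
  end.

(* Main.v *)
(** From a monochromatic induced C_2n Builder draws the n chords joining even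
vertices at distance n - 1: one of them repeats the colour of C_2n and closes
an arc of n vertices, or all of them form a C_n of the other colour.

For C_2n write d = n - 1, which is even. Builder first forces a long
monochromatic induced path. He grows a red path and a blue path and keeps a
stock of isolated edges (dominoes) of one colour, say blue. If the two ends
refuse to be extended by new vertices, then the red end has a blue domino
attached, the blue end a red leaf, and an edge between the ends lengthens one
path by more than the other loses.

Say the long path v_0, v_1, ... is blue. A vertex joined in blue to v_t and
v_(t+2d), and to nothing in between, closes a blue C_2n; so every vertex w
tested on the column {v_t, v_(t+2d)} is red to v_t or to v_(t+2d). Of three
vertices tested on a column, two agree. Testing the ends of two red paths,
which alternate between new vertices and column vertices, together with a new
vertex thus extends or joins them, until there are two disjoint red paths
a_0, ..., a_d and x_0, ..., x_d (the column vertices are not listed). On a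
further column a_0 and a_d disagree, or a red C_2n is closed, so x_(d/2)
agrees with one of them, say with a_0. On a last column x_0 and x_d disagree
and a_(d/2-1) agrees with one of them: this closes a red cycle with
d/2 + (d/2 + 1) = n listed vertices. *)

Require Import Defs.
From mathcomp Require Import all_boot all_order all_algebra.
From mathcomp Require Import boolp classical_sets functions constructive_ereal.
From mathcomp Require Import zify.

Set Implicit Arguments.
Unset Strict Implicit.
Unset Printing Implicit Defensive.

(** * Positions and forcing *)

Definition add_edge (h : position) (a b : nat) (c : bool) : position :=
  rcons h (pair_of a b, c).

Lemma pair_of_sym u v : pair_of u v = pair_of v u.
Proof. by rewrite /pair_of minnC maxnC. Qed.

Lemma pair_of_eq x y a b :
  (pair_of x y == pair_of a b) = (x == a) && (y == b) || (x == b) && (y == a).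
Proof. by rewrite /pair_of xpair_eqE; lia. Qed.

Lemma drawn_sym h u v : drawn h u v = drawn h v u.
Proof. by rewrite /drawn pair_of_sym. Qed.

Lemma colored_sym h c u v : colored h c u v = colored h c v u.
Proof. by rewrite /colored pair_of_sym. Qed.

Lemma colored_drawn h c u v : colored h c u v -> drawn h u v.
Proof. by move=> hc; apply/mapP; exists (pair_of u v, c). Qed.

Lemma drawn_add h a b c x y :
  drawn (add_edge h a b c) x y =
  [|| drawn h x y, (x == a) && (y == b) | (x == b) && (y == a)].
Proof.
by rewrite /drawn /add_edge /unzip1 map_rcons mem_rcons in_cons /= pair_of_eq orbC.
Qed.

Lemma colored_add h a b c c' x y :
  colored (add_edge h a b c) c' x y = colored h c' x y ||
  ((x == a) && (y == b) || (x == b) && (y == a)) && (c' == c).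
Proof.
by rewrite /colored /add_edge mem_rcons in_cons xpair_eqE pair_of_eq orbC.
Qed.

Lemma colored_add_new h a b c : colored (add_edge h a b c) c a b.
Proof. by rewrite colored_add !eqxx orbT. Qed.

Lemma sub_add h a b c : {subset h <= add_edge h a b c}.
Proof. by move=> e he; rewrite mem_rcons in_cons he orbT. Qed.

Lemma colored_sub h h' c u v :
  {subset h <= h'} -> colored h c u v -> colored h' c u v.
Proof. by move=> s; apply: s. Qed.

Lemma fresh_vertex h (s : seq nat) :
  exists2 z, z \notin s & forall y, ~~ drawn h z y.
Proof.
(* The successor of the sum of all entries of [s] and all endpoints in [h] exceeds each of them. *)
exists (\sum_(x <- s) x + \sum_(e <- h) (e.1.1 + e.1.2)).+1.
  apply/negP => zs; have := big_rem _ zs (op := addn) (idx := 0) (F := id) (P := xpredT).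
  by move=> /= E; have : \sum_(x <- s) x = \sum_(x <- s) id x by []; rewrite E; lia.
move=> y; apply/negP => /mapP[e he]; case: e he => -[e1 e2] c he.
rewrite /pair_of => -[E1 E2].
have := big_rem _ he (op := addn) (idx := 0) (F := fun e => e.1.1 + e.1.2) (P := xpredT).
by rewrite /=; lia.
Qed.

(** Winning in terms of the game tree instead of a global strategy: later arguments name only the
    next edge and treat Painter's two answers separately. The equivalence with [builder_wins] is
    settled once below. *)
Fixpoint forces (m : nat) (G : position -> Prop) (h : position) : Prop :=
  G h \/ if m is m'.+1 then
    exists a b, [/\ a != b, ~~ drawn h a b & forall c, forces m' G (add_edge h a b c)]
  else False.

Lemma forces_now m (G : position -> Prop) h : G h -> forces m G h.
Proof. by case: m => [|m] Gh; left. Qed.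

Lemma forces_draw m G h a b : a != b -> ~~ drawn h a b ->
  (forall c, forces m G (add_edge h a b c)) -> forces m.+1 G h.
Proof. by move=> ab hab Gc; right; exists a, b. Qed.

Lemma forces_draw_color (col : bool) m G h a b : a != b -> ~~ drawn h a b ->
  forces m G (add_edge h a b col) -> forces m G (add_edge h a b (~~ col)) ->
  forces m.+1 G h.
Proof.
move=> ab hab G1 G2; apply: (forces_draw ab hab) => c.
by case: col c G1 G2 => [] [].
Qed.

Lemma forces_leq m m' G h : m <= m' -> forces m G h -> forces m' G h.
Proof.
elim: m m' h => [|m IH] m' h le /= [Gh|]; try exact: forces_now.
  by [].
case: m' le => // m' le [a [b [ab hab Gc]]]; right; exists a, b; split=> // c.
by apply: IH => //; apply: Gc.
Qed.

Lemma forces_bind m m' (G G' : position -> Prop) h : forces m G h ->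
  (forall h', G h' -> forces m' G' h') -> forces (m + m') G' h.
Proof.
elim: m h => [|m IH] h /= [Gh|].
- exact.
- by [].
- by move=> GG'; apply: (@forces_leq m' (m.+1 + m')) (GG' h Gh); lia.
- case=> a [b [ab hab Gc]] GG'; right; exists a, b; split=> // c.
  by apply: IH => //; apply: Gc.
Qed.

Lemma new_edge_pair h a b : a != b -> ~~ drawn h a b -> new_edge h (pair_of a b).
Proof.
move=> ab hab; rewrite /new_edge /= /pair_of /=.
suff -> : drawn h (minn a b) (maxn a b) = drawn h a b.
  by rewrite hab andbT; lia.
rewrite /drawn; suff -> : pair_of (minn a b) (maxn a b) = pair_of a b by [].
by apply/eqP; rewrite pair_of_eq; lia.
Qed.

Lemma new_edge_exists h : exists e, new_edge h e.
Proof.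
have [z _ hz] := fresh_vertex h [::]; have [y yz _] := fresh_vertex h [:: z].
exists (pair_of z y); apply: new_edge_pair => //.
by move: yz; rewrite inE eq_sym.
Qed.

(** * Strategies as functions versus the game tree *)

Section Strategies.
Variables (H : sgraph).
Let G := mono_induced_copy H.

(** A strategy sees the position but not the number of rounds left, so one edge per position must
    do; it is chosen for the least count [k.+1] that suffices. *)
Lemma strategy_move h : exists e, new_edge h e /\
  forall k, forces k.+1 G h -> ~ forces 0 G h ->
    (forall k', forces k' G h -> k < k') -> forall c, forces k G (rcons h (e, c)).
Proof.
have [e0 he0] := new_edge_exists h.
have [[k [Gk [nG kmin]]]|no_k] := pselect (exists k, forces k.+1 G h /\
    (~ forces 0 G h /\ forall k', forces k' G h -> k < k')); last first.
  exists e0; split=> // k Gk nG kmin; case: no_k; exists k; split=> //.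
case: (Gk) => [Gh|[a [b [ab hab Gc]]]]; first by case: nG; left.
exists (pair_of a b); split; first exact: new_edge_pair.
move=> k' Gk' _ kmin' c.
have -> : k' = k by have := kmin k'.+1 Gk'; have := kmin' k.+1 Gk; lia.
exact: Gc.
Qed.

Lemma forces_builder_wins m : forces m G [::] -> builder_wins H m.
Proof.
move=> Gm; have [b hb] := choice strategy_move.
exists b => [h|p]; first by case: (hb h).
suff play_wins k i : forces k G (play b p i) ->
    exists2 j, j <= i + k & mono_induced_copy H (play b p j).
  by have [j jm Gj] := play_wins m 0 Gm; exists j.
elim/ltn_ind: k i => k IH i Gk.
have [[Gi|//]|nG0] := pselect (forces 0 G (play b p i)).
  by exists i => //; lia.
(* The move of [b] is good for the least sufficient count [k0.+1], so the induction passes to [k0],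
   which is below [k]. *)
have ex : exists k', `[< forces k' G (play b p i) >] by exists k; apply/asboolP.
case: (ex_minnP ex) => -[|k0] /asboolP Gk0 k0min; first by [].
have k0k : k0 < k by apply: k0min; apply/asboolP.
have [_ hmove] := hb (play b p i).
have Gnext : forces k0 G (play b p i.+1).
  apply: hmove => // k' Gk'; apply: k0min; exact/asboolP.
by have [j ji Gj] := IH k0 k0k i.+1 Gnext; exists j => //; lia.
Qed.

(** By contraposition: in a position that Builder cannot win in the rounds left, every new edge has
    an answer that leads to another such position. *)
Lemma builder_wins_forces m : builder_wins H m -> forces m G [::].
Proof.
case=> b hb win; apply: contrapT => nG.
(* Painter answers [true] unless this lets Builder win in the remaining rounds; their number is read
   off from the length of the position. *)
pose p h e := ~~ `[< forces (m - (size h).+1) G (rcons h (e, true)) >].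
have psize k : size (play b p k) = k by elim: k => //= k IH; rewrite size_rcons IH.
have lose k : k <= m -> ~ forces (m - k) G (play b p k).
  elim: k => [|k IH] km; first by rewrite subn0.
  have {}IH := IH (ltnW km); rewrite /= => Gk; apply: IH.
  move: (play b p k) (psize k) Gk => h sh Gk.
  have -> : m - k = (m - k.+1).+1 by lia.
  have /andP[ab hab] := hb h.
  have eb : b h = pair_of (b h).1 (b h).2.
    by rewrite /pair_of; case: (b h) ab => x y /= xy; congr pair; lia.
  apply: (forces_draw _ hab); first by rewrite neq_ltn ab.
  rewrite /add_edge -eb; move: Gk; rewrite /p sh.
  by case: asboolP => [Gt Gf|nGt Gt] [].
have [k km Gk] := win p.
by apply: (lose k km); apply: forces_now.
Qed.

Lemma r_ind_le_forces m : forces m G [::] -> (r_ind H <= (m%:Z)%:E)%E.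
Proof.
move=> /forces_builder_wins win; rewrite /r_ind; case: pselect => [ex|[]].
  by rewrite lee_fin; case: ex_minnP => k _ /(_ m) kmin; have := kmin (asboolT win); lia.
by exists m; apply/asboolP.
Qed.

Lemma r_ind_forces : r_ind H = +oo%E \/
  exists2 m, r_ind H = (m%:Z)%:E & forces m G [::].
Proof.
rewrite /r_ind; case: pselect => [ex|_]; last by left.
right; case: ex_minnP => m /asboolP win _; exists m => //.
exact: builder_wins_forces.
Qed.

End Strategies.

(** * From the cycle of length 2n to the cycle of length n *)

Definition loopless (h : position) : Prop := forall u, ~~ drawn h u u.

(** Builder never draws a loop, so a goal may assume that there is none. An induced copy needs this,
    since [drawn] is also evaluated at equal arguments. *)
Lemma forces_loopless m (G : position -> Prop) h : loopless h ->
  forces m (fun h' => loopless h' -> G h') h -> forces m G h.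
Proof.
elim: m h => [|m IH] h lh; case=> [Gh|]; try by left; apply: Gh.
  by [].
move=> [a [b [ab hab Gc]]]; apply: (forces_draw ab hab) => c.
apply: IH (Gc c) => u; rewrite drawn_add (negbTE (lh u)) /=; lia.
Qed.

Lemma cycle_edge_lt N (i j : 'I_N) : i < j ->
  cycle_edge i j = (j == i.+1 :> nat) || (i == 0 :> nat) && (j == N.-1 :> nat).
Proof.
move=> ij; have jN := ltn_ord j; rewrite /cycle_edge -!val_eqE /=.
have -> : i.+1 %% N = i.+1 by rewrite modn_small //; lia.
have [jN1|jN1] := eqVneq (j : nat) N.-1.
  have -> : j.+1 = N by lia.
  by rewrite modnn; lia.
have -> : j.+1 %% N = j.+1 by rewrite modn_small //; lia.
lia.
Qed.

Lemma mono_cycle_copy N h c (F : nat -> nat) :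
  (forall i, i < N -> ~~ drawn h (F i) (F i)) ->
  (forall i j, i < j < N -> F i != F j /\
     if (j == i.+1) || (i == 0) && (j == N.-1) then colored h c (F i) (F j)
     else ~~ drawn h (F i) (F j)) ->
  mono_induced_copy (cycle_graph N) h.
Proof.
move=> Floop FN.
exists [set` [seq F i | i <- iota 0 N]]%classic, (fun i : 'I_N => F i), c.
have Finj i j : i < N -> j < N -> F i = F j -> i = j.
  move=> iN jN; case: (ltngtP i j) => // ij.
    by have [/eqP] := FN i j (introT andP (conj ij jN)).
  by have [/eqP ne _] := FN j i (introT andP (conj ij iN)) => /esym.
have Fmem x : x \in [seq F i | i <- iota 0 N] -> exists2 i : 'I_N, True & x = F i.
  by move=> /mapP[i]; rewrite mem_iota => iN ->; exists (Ordinal iN).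
have Fedge (i j : 'I_N) : cycle_edge i j = drawn h (F i) (F j).
  wlog le_ij : i j / i <= j.
    by move=> W; case: (leqP i j) => [|/ltnW] ij; last
       rewrite cycle_edge_sym drawn_sym; apply: W.
  have [eq_ij|ne_ij] := eqVneq i j.
    by rewrite -eq_ij cycle_edge_irr (negbTE (Floop _ (ltn_ord i))).
  have lt_ij : i < j by rewrite ltn_neqAle le_ij andbT.
  have [_] := FN i j (introT andP (conj lt_ij (ltn_ord j))).
  rewrite cycle_edge_lt //; case: ifP => _; first by move/colored_drawn->.
  by move/negbTE->.
have Fcol (i j : 'I_N) : drawn h (F i) (F j) -> colored h c (F i) (F j).
  wlog le_ij : i j / i <= j.
    by move=> W; case: (leqP i j) => [|/ltnW] ij; last
       rewrite colored_sym drawn_sym; apply: W.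
  have [eq_ij|ne_ij] := eqVneq i j.
    by rewrite -eq_ij (negbTE (Floop _ (ltn_ord i))).
  have lt_ij : i < j by rewrite ltn_neqAle le_ij andbT.
  have [_] := FN i j (introT andP (conj lt_ij (ltn_ord j))).
  by case: ifP => // _ /negbTE->.
split=> //.
- split.
  + by move=> i _ /=; apply/mapP; exists (i : nat); rewrite // mem_iota ltn_ord.
  + by move=> i j _ _ eq_ij; apply: val_inj; apply: Finj => //; apply: ltn_ord.
  + by move=> x /= /Fmem[i _ ->]; exists i.
- by move=> u v /= /Fmem[i _ ->] /Fmem[j _ ->]; apply: Fcol.
Qed.

(** Draws a fixed list of edges whatever the answers are; afterwards [drawn] is known exactly, while
    the colours of the new edges stay open. *)
Lemma forces_draws m G h (es : seq (nat * nat)) :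
  (forall e, e \in es -> e.1 != e.2 /\ ~~ drawn h e.1 e.2) ->
  uniq [seq pair_of e.1 e.2 | e <- es] ->
  (forall h', {subset h <= h'} ->
     (forall x y, drawn h' x y =
        drawn h x y || (pair_of x y \in [seq pair_of e.1 e.2 | e <- es])) ->
     forces m G h') ->
  forces (size es + m) G h.
Proof.
elim: es h => [|[a b] es IH] h hes /=.
  by move=> _ Gh; apply: Gh => // x y; rewrite in_nil orbF.
case/andP=> ab_es es_uniq Gh.
have [/= ab hab] := hes (a, b) (mem_head _ _).
apply: (forces_draw ab hab) => c; apply: IH => //.
  move=> e e_es; have [e12 he] := hes e (@mem_behead _ (_ :: _) _ e_es).
  split=> //; rewrite drawn_add (negbTE he) /= -pair_of_eq.
  by apply: contra ab_es => /eqP <-; apply/mapP; exists e.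
move=> h' sub_h' drawn_h'; apply: Gh.
  by move=> e he; apply: sub_h'; apply: sub_add.
by move=> x y; rewrite drawn_h' drawn_add -pair_of_eq in_cons orbA.
Qed.

Lemma drawn_colored h c u v : drawn h u v -> colored h c u v \/ colored h (~~ c) u v.
Proof.
case/mapP=> -[e c'] he /= E; rewrite /colored E.
by case: c c' he => [] []; [left|right|right|left].
Qed.

(* The chords of the cycle 0, ..., 2n-1 between even positions at distance
   n - 1 or n + 1 form a cycle of length n, visited in the order
   0, n + 1, 2, n + 3, ..., n - 1. *)
Definition chord_pos (n i : nat) : nat := if odd i then n + i else i.

(** A chord of the colour of C_2n closes an arc of n vertices; inside this arc only the two ends are
    at distance n - 1, so the result is induced. Without such a chord the cycle of chords has the
    other colour, and it is induced because even positions are joined by chords only. *)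
Lemma mono_copy_half n h : 2 < n -> odd n ->
  mono_induced_copy (cycle_graph (2 * n)) h ->
  forces n (mono_induced_copy (cycle_graph n)) h.
Proof.
move=> n3 n_odd [S [f [c [[fS f_inj _] f_edge f_col]]]].
have n2 : 0 < 2 * n by lia.
(* Indices are taken modulo 2n, so that arcs may run past position 2n - 1. *)
pose F k := f (Ordinal (ltn_pmod k n2)).
have FE i j : i < j -> j < 2 * n ->
    [/\ F i != F j, drawn h (F i) (F j) = (j == i.+1) || (i == 0) && (j == (2 * n).-1)
      & drawn h (F i) (F j) -> colored h c (F i) (F j)].
  move=> ij jn; split.
  - apply/eqP => /(f_inj _ _ (in_setT _) (in_setT _)) /(congr1 val) /=.
    by rewrite !modn_small; lia.
  - by rewrite -f_edge /= cycle_edge_lt /= !modn_small //; lia.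
  - by apply: f_col; apply: fS.
have Floop i : ~~ drawn h (F i) (F i) by rewrite -f_edge edge_irr.
have Fmod i : F i = F (i %% (2 * n)).
  by congr f; apply: val_inj; rewrite /= modn_mod.
have FEne i j : i < 2 * n -> j < 2 * n -> (F i == F j) = (i == j).
  move=> iN jN; apply/eqP/eqP => [|-> //]; case: (ltngtP i j) => // ij.
    by have [/eqP] := FE _ _ ij jN.
  by have [/eqP ne _ _] := FE _ _ ij iN => /esym.
have Fnext k : colored h c (F k) (F k.+1).
  have -> : F k.+1 = F (k %% (2 * n)).+1.
    by rewrite Fmod [RHS]Fmod -addn1 -modnDml addn1.
  rewrite Fmod; have := ltn_pmod k n2; move: (k %% _) => r rN.
  have [lr|lr] := ltnP r.+1 (2 * n).
    by have [_ E] := FE _ _ (ltnSn r) lr; apply; rewrite E eqxx.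
  have -> : F r.+1 = F 0.
    have -> : r.+1 = 2 * n by lia.
    by rewrite Fmod modnn.
  have r0 : 0 < r by lia.
  rewrite colored_sym; have [_ E] := FE _ _ r0 rN; apply; rewrite E.
  lia.
(* [nxt] is the successor on the cycle of chords, and [es] lists the chords in this cyclic order. *)
pose nxt i := if i == n.-1 then 0 else i.+1.
pose es := [seq (F (chord_pos n i), F (chord_pos n (nxt i))) | i <- iota 0 n].
have pos_lt i : i < n -> chord_pos n i < 2 * n.
  by rewrite /chord_pos; case: ifP; lia.
have nxt_lt i : i < n -> nxt i < n by rewrite /nxt; case: ifP; lia.
have pos_even i : i < n -> ~~ odd (chord_pos n i).
  by rewrite /chord_pos; case: ifP; lia.
have chord p q : p < 2 * n -> q < 2 * n ->
    (pair_of (F p) (F q) \in [seq pair_of e.1 e.2 | e <- es]) =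
    [&& ~~ odd p, ~~ odd q & [|| q == p + n.-1, q == p + n.+1, p == q + n.-1
      | p == q + n.+1]].
  move=> pN qN; rewrite -map_comp; apply/mapP/idP => [[i]|].
    rewrite mem_iota /= => iN /eqP; rewrite pair_of_eq !FEne ?pos_lt ?nxt_lt //.
    by rewrite /chord_pos /nxt; do !case: ifP; lia.
  move=> /and3P[p_even q_even pq].
  have [i iN Ei] : exists2 i, i < n & ((p == chord_pos n i) && (q == chord_pos n (nxt i)))
      || ((p == chord_pos n (nxt i)) && (q == chord_pos n i)).
    (* Odd [i] gives a chord of difference n - 1, even [i] below n - 1 one of difference n + 1, and
       [i = n - 1] joins n - 1 to 0. *)
    case/or4P: pq => /eqP pq.
    - exists (if p == 0 then n.-1 else p.-1); first by case: ifP; lia.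
      by rewrite /chord_pos /nxt; do !case: ifP; lia.
    - exists p; first by lia.
      by rewrite /chord_pos /nxt; do !case: ifP; lia.
    - exists (if q == 0 then n.-1 else q.-1); first by case: ifP; lia.
      by rewrite /chord_pos /nxt; do !case: ifP; lia.
    - exists q; first by lia.
      by rewrite /chord_pos /nxt; do !case: ifP; lia.
  exists i; first by rewrite mem_iota.
  by apply/eqP; rewrite pair_of_eq !FEne ?pos_lt ?nxt_lt.
have size_es : size es = n by rewrite size_map size_iota.
suff: forces (size es + 0) (mono_induced_copy (cycle_graph n)) h.
  by rewrite size_es addn0.
apply: forces_draws.
- move=> e /mapP[i]; rewrite mem_iota /= => iN -> /=.
  have [pi pn] := (pos_lt i iN, pos_lt _ (nxt_lt i iN)).
  split; first by rewrite FEne // /chord_pos /nxt; do !case: ifP; lia.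
  move: (chord_pos n i) (chord_pos n (nxt i)) pi pn (pos_even i iN)
    (pos_even _ (nxt_lt i iN)) => p q pN qN p_even q_even.
  case: (ltngtP p q) => pq; last by rewrite pq.
    by have [_ -> _] := FE _ _ pq qN; lia.
  by rewrite drawn_sym; have [_ -> _] := FE _ _ pq pN; lia.
- rewrite -map_comp map_inj_in_uniq ?iota_uniq // => i j.
  rewrite !mem_iota /= => iN jN /eqP; rewrite pair_of_eq !FEne ?pos_lt ?nxt_lt //.
  by rewrite /chord_pos /nxt; do !case: ifP; lia.
move=> h' sub_h' drawn_h'; apply: forces_now.
have drawnF p q : p < q -> q < 2 * n -> drawn h' (F p) (F q) =
    [|| q == p.+1, (p == 0) && (q == (2 * n).-1) | [&& ~~ odd p, ~~ odd q &
      (q == p + n.-1) || (q == p + n.+1)]].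
  move=> pq qN; have [_ E _] := FE _ _ pq qN.
  by rewrite drawn_h' E chord; lia.
have Floop' p : p < 2 * n -> ~~ drawn h' (F p) (F p).
  by move=> pN; rewrite drawn_h' (negbTE (Floop p)) chord //; lia.
have [[p [q [pq qN p_even q_even /andP[dpq cpq]]]]|no_blue] := pselect (exists p q,
    [/\ p < q, q < 2 * n, ~~ odd p, ~~ odd q &
      drawn h' (F p) (F q) && colored h' c (F p) (F q)]).
  move: dpq; rewrite drawnF // => dpq.
  (* The arc starts at [p] if the difference is n - 1. Otherwise it starts at [q] and wraps around
     to [p], since q + (n - 1) = p + 2n. *)
  have [st [stN st_even st_blue]] : exists st, [/\ st < 2 * n, ~~ odd st &
      colored h' c (F st) (F (st + n.-1))].
    have [qE|qE] := eqVneq q (p + n.-1).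
      by exists p; rewrite -qE; split=> //; lia.
    exists q; split=> //; rewrite colored_sym [F (q + _)]Fmod.
    have -> : q + n.-1 = p + 2 * n by lia.
    by rewrite modnDr modn_small //; lia.
  clear - n3 n_odd stN st_even st_blue drawnF FEne Fmod Floop' Fnext sub_h'.
  (* The three cases are: no index wraps around, only [j] does, or both do. *)
  have arc i j : i < j -> j < n -> F (st + i) != F (st + j) /\
      drawn h' (F (st + i)) (F (st + j)) = (j == i.+1) || (i == 0) && (j == n.-1).
    move=> ij jN; rewrite Fmod [F (st + j)]Fmod.
    have [lj|lj] := ltnP (st + j) (2 * n).
      have li : st + i < 2 * n by lia.
      have lij : st + i < st + j by lia.
      rewrite !modn_small // FEne // drawnF //; split; first by lia.
      by apply/idP/idP; lia.
    have -> : (st + j) %% (2 * n) = st + j - 2 * n.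
      by rewrite -[in LHS](subnK lj) modnDr modn_small //; lia.
    have lj' : st + j - 2 * n < 2 * n by lia.
    have [li|li] := ltnP (st + i) (2 * n).
      have lij : st + j - 2 * n < st + i by lia.
      rewrite modn_small // FEne // drawn_sym drawnF //; split; first by lia.
      by apply/idP/idP; lia.
    have -> : (st + i) %% (2 * n) = st + i - 2 * n.
      by rewrite -[in LHS](subnK li) modnDr modn_small //; lia.
    have li' : st + i - 2 * n < 2 * n by lia.
    have lij : st + i - 2 * n < st + j - 2 * n by lia.
    rewrite FEne // drawnF //; split; first by lia.
    by apply/idP/idP; lia.
  apply: (@mono_cycle_copy n h' c (fun i => F (st + i))) => [i iN|i j /andP[ij jN]].
    by rewrite Fmod; apply: Floop'; rewrite ltn_mod; lia.
  have [ne dE] := arc _ _ ij jN; split=> //; rewrite -dE.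
  case: ifP => [|->//]; rewrite dE => /orP[/eqP j_eq|/andP[/eqP-> /eqP->]].
    by rewrite j_eq addnS; apply: (colored_sub sub_h').
  by rewrite addn0.
(* Two even positions are not neighbours on C_2n, so an edge between them is a chord, and [no_blue]
   gives it the other colour. *)
have red p q : p < 2 * n -> q < 2 * n -> ~~ odd p -> ~~ odd q ->
    drawn h' (F p) (F q) = [|| q == p + n.-1, q == p + n.+1, p == q + n.-1
      | p == q + n.+1] /\
    (drawn h' (F p) (F q) -> colored h' (~~ c) (F p) (F q)).
  wlog pq : p q / p <= q.
    move=> W pN qN po qo; case: (leqP p q) => [|/ltnW] pq; first exact: W.
    by rewrite drawn_sym colored_sym; have [-> H] := W q p pq qN pN qo po; split=> //; lia.
  move=> pN qN po qo; have [->|ne] := eqVneq p q.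
    by rewrite (negbTE (Floop' q qN)); split=> //; lia.
  have {}pq : p < q by lia.
  split; first by rewrite drawnF //; lia.
  move=> dpq; case: (drawn_colored c dpq) => // cpq.
  by case: no_blue; exists p, q; split=> //; rewrite dpq.
apply: (@mono_cycle_copy n h' (~~ c) (fun i => F (chord_pos n i))) => [i iN|i j /andP[ij jN]].
  by apply: Floop'; apply: pos_lt.
have iN : i < n by apply: ltn_trans jN.
rewrite FEne ?pos_lt //.
have ne : chord_pos n i != chord_pos n j by rewrite /chord_pos; do !case: ifP; lia.
have [dE cE] := red _ _ (pos_lt _ iN) (pos_lt _ jN) (pos_even _ iN) (pos_even _ jN).
split=> //; suff -> : (j == i.+1) || (i == 0) && (j == n.-1) =
    drawn h' (F (chord_pos n i)) (F (chord_pos n j)).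
  by case: ifP => [/cE|->].
by rewrite dE /chord_pos; do !case: ifP; lia.
Qed.

(** * Induced monochromatic paths *)

Definition apart (h : position) (s t : seq nat) : bool :=
  all (fun x => all (fun y => (x != y) && ~~ drawn h x y) t) s.

Lemma apartP h s t : reflect
  (forall x y, x \in s -> y \in t -> x != y /\ ~~ drawn h x y) (apart h s t).
Proof.
apply: (iffP allP) => [A x y xs yt|A x xs].
  by have /allP/(_ y yt)/andP := A x xs.
by apply/allP => y yt; apply/andP; apply: A.
Qed.

Lemma apart_sym h s t : apart h s t = apart h t s.
Proof.
by apply/apartP/apartP => A x y xs yt; rewrite eq_sym drawn_sym; apply: A.
Qed.

Lemma apart_consl h x s t : apart h (x :: s) t = apart h [:: x] t && apart h s t.
Proof. by rewrite /apart /= andbT. Qed.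

Lemma apart_consr h x s t : apart h s (x :: t) = apart h s [:: x] && apart h s t.
Proof. by rewrite apart_sym apart_consl !(apart_sym h s). Qed.

Lemma apart_sub h s t s' t' : {subset s' <= s} -> {subset t' <= t} ->
  apart h s t -> apart h s' t'.
Proof. by move=> ss st /apartP A; apply/apartP => x y /ss xs /st; apply: A. Qed.

Lemma apart_mono h h' s t :
  (forall x y, x \in s -> y \in t -> drawn h' x y -> drawn h x y) ->
  apart h s t -> apart h' s t.
Proof.
move=> H /apartP A; apply/apartP => x y xs yt; have [ne nd] := A x y xs yt.
by split=> //; apply: contra nd; apply: H.
Qed.

Lemma apart_add h s t a b c :
  ~~ ((a \in s) && (b \in t)) -> ~~ ((b \in s) && (a \in t)) ->
  apart h s t -> apart (add_edge h a b c) s t.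
Proof.
move=> n1 n2; apply: apart_mono => x y xs yt; rewrite drawn_add.
case/or3P=> // /andP[/eqP E1 /eqP E2]; [case/negP: n1|case/negP: n2];
  by rewrite -E1 -E2 xs yt.
Qed.

Lemma apart_fresh h z s : z \notin s -> (forall y, ~~ drawn h z y) -> apart h [:: z] s.
Proof.
move=> zs hz; apply/apartP => x y; rewrite inE => /eqP-> ys; split=> //.
by apply: contra zs => /eqP->.
Qed.

Fixpoint ipath (h : position) (c : bool) (s : seq nat) : bool :=
  if s is x :: s' then
    (if s' is y :: t then [&& x != y, colored h c x y & apart h [:: x] t] else true)
    && ipath h c s'
  else true.

Lemma ipath_cons h c x y t :
  ipath h c (x :: y :: t) =
  [&& x != y, colored h c x y, apart h [:: x] t & ipath h c (y :: t)].
Proof. by rewrite /= -!andbA. Qed.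

Lemma ipath_mono h h' c s : {subset h <= h'} ->
  (forall x y, x \in s -> y \in s -> drawn h' x y -> drawn h x y) ->
  ipath h c s -> ipath h' c s.
Proof.
move=> sub; elim: s => // x [//|y t] IH H; rewrite !ipath_cons.
case/and4P=> xy cxy axt it; apply/and4P; split=> //.
- exact: colored_sub cxy.
- apply: apart_mono axt => a b; rewrite inE => /eqP-> bt; apply: H;
    by rewrite !inE ?eqxx ?bt ?orbT.
- by apply: IH => // a b at_ bt; apply: H; rewrite in_cons ?at_ ?bt orbT.
Qed.

Lemma ipath_add h c s a b c' : ~~ ((a \in s) && (b \in s)) ->
  ipath h c s -> ipath (add_edge h a b c') c s.
Proof.
move=> nab; apply: ipath_mono => [|x y xs ys]; first exact: sub_add.
rewrite drawn_add; case/or3P=> // /andP[/eqP E1 /eqP E2]; case/negP: nab;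
  by rewrite -E1 -E2 xs ys.
Qed.

(** Reversing [s] onto [t] moves the vertices one at a time across the shared vertex [x]; both sides
    remain induced paths. *)
Lemma ipath_catrev h c x s t :
  ipath h c (x :: s) -> ipath h c (x :: t) -> apart h s t ->
  ipath h c (catrev s (x :: t)).
Proof.
elim: s x t => // y s IH x t; rewrite ipath_cons => /and4P[xy cxy axs iys] ixt.
rewrite apart_consl => /andP[ayt ast] /=; apply: IH => //.
  by rewrite ipath_cons eq_sym xy colored_sym cxy ayt.
by rewrite apart_consr apart_sym axs.
Qed.

Lemma ipath_join h c x s t :
  ipath h c (x :: s) -> ipath h c (x :: t) -> apart h s t ->
  ipath h c (rev s ++ x :: t).
Proof. by rewrite -catrevE; apply: ipath_catrev. Qed.

Lemma ipath_rev h c s : ipath h c s -> ipath h c (rev s).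
Proof.
case: s => // x s ixs; rewrite rev_cons -cats1; apply: ipath_join => //.
by apply/apartP.
Qed.

Lemma ipath_catr h c s t : ipath h c (s ++ t) -> ipath h c t.
Proof. by elim: s => //= x s IH /andP[_ /IH]. Qed.

Lemma ipath_catl h c s t : ipath h c (s ++ t) -> ipath h c s.
Proof.
by move/ipath_rev; rewrite rev_cat => /ipath_catr/ipath_rev; rewrite revK.
Qed.

(** Removing an inner vertex separates an induced path; one long red path is later cut into two in
    this way. *)
Lemma ipath_split h c s x t : ipath h c (s ++ x :: t) -> apart h s t.
Proof.
elim: s => // y s IH; rewrite cat_cons => i; rewrite apart_consl IH ?andbT.
  case: s i {IH} => [|z s]; rewrite ?cat0s ?cat_cons ipath_cons; first by case/and4P.
  by case/and4P=> _ _ A _; apply: apart_sub A => // w wt; rewrite mem_cat in_cons wt !orbT.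
by move: i => /=; case/andP.
Qed.

Lemma ipathP h c s : reflect
  (forall i j, i < j < size s -> nth 0 s i != nth 0 s j /\
     if j == i.+1 then colored h c (nth 0 s i) (nth 0 s j)
     else ~~ drawn h (nth 0 s i) (nth 0 s j))
  (ipath h c s).
Proof.
elim: s => [|x [|y t] IH]; try by apply: (iffP idP) => // _ i j /=; lia.
rewrite ipath_cons; apply: (iffP and4P) => [[xy cxy axt /IH H]|H].
  move=> [|i] [|[|j]] //= ij; try by apply: (H i j.+1).
  by apply: (apartP _ _ _ axt); rewrite ?inE // mem_nth //; move: ij; lia.
split.
- by have [] := H 0 1 isT.
- by have [] := H 0 1 isT.
- apply/apartP => a b; rewrite inE => /eqP-> /(nthP 0)[k kt <-].
  by have := H 0 k.+2; apply.
- by apply/IH => i j ij; apply: (H i.+1 j.+1).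
Qed.

Lemma ipath_uniq h c s : ipath h c s -> uniq s.
Proof.
move/ipathP => H; apply/(uniqP 0) => i j iN jN E.
case: (ltngtP i j) => // ij.
  by have [] := H i j (introT andP (conj ij jN)); rewrite E eqxx.
by have [] := H j i (introT andP (conj ij iN)); rewrite E eqxx.
Qed.

Lemma ipath_cycle_copy h c x s : loopless h ->
  ipath h c s ->
  (forall i, i < size s -> x != nth 0 s i /\
    if (i == 0) || (i == (size s).-1) then colored h c x (nth 0 s i)
    else ~~ drawn h x (nth 0 s i)) ->
  mono_induced_copy (cycle_graph (size s).+1) h.
Proof.
move=> lh /ipathP si xi.
apply: (@mono_cycle_copy _ _ c (nth 0 (x :: s))) => [i _|]; first exact: lh.
move=> [|i] [|j] //= ij.
  have [ne xj] := xi j ij; split=> //.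
  suff -> : (j.+1 == 1) || (0 == 0) && (j.+1 == size s) =
      (j == 0) || (j == (size s).-1) by [].
  by move: ij; lia.
by have [] := si i j ij; split=> //; rewrite orbF.
Qed.

(** * Forcing a long induced path *)

Ltac notin := rewrite ?in_cons ?in_nil; repeat match goal with
  | K : is_true (?a \notin ?L) |- context [?a \in ?L] => rewrite (negbTE K)
  | K : is_true (?a != ?b) |- context [?a == ?b] => rewrite (negbTE K)
  | K : is_true (?a != ?b) |- context [?b == ?a] => rewrite [b == a]eq_sym (negbTE K)
  end; rewrite ?andbF ?andbT ?orbF ?eqxx //.

Lemma apart_notin h s t a : apart h s t -> a \in s -> a \notin t.
Proof.
by move=> /apartP A a_s; apply/negP => a_t; have [/eqP] := A a a a_s a_t.
Qed.

Lemma apart_notinr h s t a : apart h s t -> a \in t -> a \notin s.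
Proof. by rewrite apart_sym; apply: apart_notin. Qed.

Lemma apart_ndrawn h s t a b : apart h s t -> a \in s -> b \in t -> ~~ drawn h a b.
Proof. by move=> /apartP A a_s b_t; have [] := A a b a_s b_t. Qed.

Lemma apart_neq h s t a b : apart h s t -> a \in s -> b \in t -> a != b.
Proof. by move=> /apartP A a_s b_t; have [] := A a b a_s b_t. Qed.

(** * A stock of dominoes and two growing paths *)

Definition flat (ds : seq (nat * nat)) : seq nat :=
  flatten [seq [:: p.1; p.2] | p <- ds].

Fixpoint dominoes (h : position) (c : bool) (ds : seq (nat * nat)) : bool :=
  if ds is p :: ds' then
    [&& ipath h c [:: p.1; p.2], apart h [:: p.1; p.2] (flat ds') & dominoes h c ds']
  else true.

Lemma dominoes_cons h c p q ds : dominoes h c ((p, q) :: ds) =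
  [&& ipath h c [:: p; q], apart h [:: p; q] (flat ds) & dominoes h c ds].
Proof. by []. Qed.

Lemma dominoes_add h c ds a b c' : a \notin flat ds ->
  dominoes h c ds -> dominoes (add_edge h a b c') c ds.
Proof.
elim: ds => // -[p q] ds IH.
have -> : flat ((p, q) :: ds) = [:: p, q & flat ds] by [].
rewrite !in_cons !negb_or !dominoes_cons => /and3P[ap aq ads].
case/and3P=> ipq apq /IH dds; apply/and3P; split; last exact: dds.
- by apply: ipath_add => //; notin.
- by apply: apart_add => //; notin.
Qed.

(** Pigeonhole: of 2j disjoint edges on new vertices, j have the same colour. Painter decides which,
    so the hypothesis quantifies over [c]. *)
Lemma forces_dominoes j m G h :
  (forall h' c ds, size ds = j -> dominoes h' c ds -> forces m G h') ->
  forces (2 * j + m) G h.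
Proof.
move=> Gj; suff gen k ds1 ds2 h' : dominoes h' true ds1 -> dominoes h' false ds2 ->
    2 * j <= size ds1 + size ds2 + k -> forces (k + m) G h'.
  by apply: (gen _ [::] [::]) => //=; lia.
have take_j c ds h0 : dominoes h0 c ds -> j <= size ds -> forces m G h0.
  move=> dds jds; apply: (Gj _ c (drop (size ds - j) ds)); first by rewrite size_drop; lia.
  move: (size ds - j) => i; elim: i ds {jds} dds => [|i IH] [|[p q] ds] //.
  by rewrite dominoes_cons => /and3P[_ _]; apply: IH.
elim: k ds1 ds2 h' => [|k IH] ds1 ds2 h' d1 d2 le.
  have [le1|le2] : j <= size ds1 \/ j <= size ds2 by lia.
    exact: take_j d1 le1.
  exact: take_j d2 le2.
have [a a_n a_f] := fresh_vertex h' (flat ds1 ++ flat ds2).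
have [b b_n b_f] := fresh_vertex h' (a :: flat ds1 ++ flat ds2).
move: a_n b_n; rewrite in_cons !mem_cat !negb_or => /andP[a1 a2] /and3P[ba b1 b2].
have new c ds : a \notin flat ds -> b \notin flat ds -> dominoes h' c ds ->
    dominoes (add_edge h' a b c) c ((a, b) :: ds).
  move=> an bn dds; rewrite dominoes_cons; apply/and3P; split; last exact: dominoes_add.
    by rewrite ipath_cons /= colored_add_new eq_sym ba.
  rewrite apart_consl; apply/andP; split; apply: apart_add; try by notin.
    exact: apart_fresh.
  exact: apart_fresh.
rewrite addSn; apply: (@forces_draw _ _ _ a b) => [||[]]; rewrite ?a_f 1?eq_sym //.
  by apply: (IH ((a, b) :: ds1) ds2); [apply: new|apply: dominoes_add|move=> /=; lia].
by apply: (IH ds1 ((a, b) :: ds2)); [apply: dominoes_add|apply: new|move=> /=; lia].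
Qed.

(** The colour [c] acts as blue. The dominoes share it with [B], so that a domino attached in blue
    to the head of [R] can pass to [B] together with this head. *)
Definition growing (h : position) (c : bool) (R B : seq nat) (ds : seq (nat * nat)) :=
  [/\ ipath h (~~ c) R, ipath h c B, apart h R B, dominoes h c ds
    & apart h R (flat ds) /\ apart h B (flat ds)].

(** A path that has lost all its vertices restarts at the fresh vertex [f], so that both heads
    always exist. *)
Lemma growing_refillR h c R B ds f : f \notin B -> f \notin flat ds ->
  (forall y, ~~ drawn h f y) -> growing h c R B ds ->
  exists R', [/\ growing h c R' B ds, 0 < size R' & size R <= size R'].
Proof.
move=> fB fds hf; case: R => [|x R] gr; last by exists (x :: R).
exists [:: f]; case: gr => _ iB _ dds [_ aB]; split=> //; split=> //.
  exact: apart_fresh.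
by split=> //; apply: apart_fresh.
Qed.

Lemma growing_refillB h c R B ds f : f \notin R -> f \notin flat ds ->
  (forall y, ~~ drawn h f y) -> growing h c R B ds ->
  exists B', [/\ growing h c R B' ds, 0 < size B' & size B <= size B'].
Proof.
move=> fR fds hf; case: B => [|x B] gr; last by exists (x :: B).
exists [:: f]; case: gr => iR _ _ dds [aR _]; split=> //; split=> //.
  by rewrite apart_sym; apply: apart_fresh.
by split=> //; apply: apart_fresh.
Qed.

(* With weights 5 for R and 4 for B both answers to the edge between the heads
   gain 2, since 3 * 4 - 2 * 5 = 2 * 5 - 2 * 4 = 2. *)
Lemma growing_step m G h c R B ds : 0 < size R -> 0 < size B -> 0 < size ds ->
  growing h c R B ds ->
  (forall h' R' B' ds', growing h' c R' B' ds' -> 0 < size R' -> 0 < size B' ->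
    (size ds).-1 <= size ds' ->
    5 * size R + 4 * size B + 2 <= 5 * size R' + 4 * size B' -> forces m G h') ->
  forces (3 + m) G h.
Proof.
case: R => // x R; case: B => // y B; case: ds => // -[q q'] ds _ _ _ gr next.
have [f f_n hf] := fresh_vertex h ((x :: R) ++ (y :: B) ++ [:: q, q' & flat ds]).
have [u u_n hu] := fresh_vertex h (f :: (x :: R) ++ (y :: B) ++ [:: q, q' & flat ds]).
move: f_n u_n; rewrite !(mem_cat, in_cons) !negb_or -!andbA.
case/and5P=> fx fR fy fB /and3P[fq fq' fds] /and5P[uf ux uR uy /and4P[uB uq uq' uds]].
case: gr => iR iB aRB; rewrite dominoes_cons => /and3P[iqq' aqds dds].
have -> : flat ((q, q') :: ds) = [:: q, q' & flat ds] by [].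
case=> aRds aBds; move: (iqq'); rewrite ipath_cons => /and4P[qq' cqq' _ _].
have xy : x != y by apply: (apart_neq aRB); rewrite mem_head.
have xB : x \notin B.
  by have := apart_notin aRB (mem_head x R); rewrite in_cons negb_or => /andP[].
have yR : y \notin R.
  by have := apart_notinr aRB (mem_head y B); rewrite in_cons negb_or => /andP[].
have /and3P[xq xq' xds] : [&& x != q, x != q' & x \notin flat ds].
  by move: (apart_notin aRds (mem_head x R)); rewrite !in_cons !negb_or.
have /and3P[yq yq' yds] : [&& y != q, y != q' & y \notin flat ds].
  by move: (apart_notin aBds (mem_head y B)); rewrite !in_cons !negb_or.
have xR : x \notin R by case/andP: (ipath_uniq iR).
have yB : y \notin B by case/andP: (ipath_uniq iB).
have qR : q \notin R.
  by have := apart_notinr aRds (mem_head q _); rewrite in_cons negb_or => /andP[].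
have qB : q \notin B.
  by have := apart_notinr aBds (mem_head q _); rewrite in_cons negb_or => /andP[].
have qds : q \notin flat ds by apply: (apart_notin aqds); rewrite mem_head.
have q'in : q' \in [:: q, q' & flat ds] by rewrite !in_cons eqxx orbT.
have q'R : q' \notin R.
  by have := apart_notinr aRds q'in; rewrite in_cons negb_or => /andP[].
have q'B : q' \notin B.
  by have := apart_notinr aBds q'in; rewrite in_cons negb_or => /andP[].
have q'ds : q' \notin flat ds by apply: (apart_notin aqds); rewrite !inE eqxx orbT.
move: (aRB); rewrite apart_consl !(apart_consr _ y _ B) => /andP[/andP[axy axB] /andP[aRy aRB']].
move: (aRds); rewrite apart_consl !(apart_consr _ q _ (q' :: _)) !(apart_consr _ q' _ (flat ds)) =>
  /andP[/and3P[axq axq' axds] /and3P[aRq aRq' aRds']].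
move: (aBds); rewrite apart_consl !(apart_consr _ q _ (q' :: _)) !(apart_consr _ q' _ (flat ds)) =>
  /andP[/and3P[ayq ayq' ayds] /and3P[aBq aBq' aBds']].
move: (aqds); rewrite apart_consl => /andP[aqds1 aqds2].
have ufresh L : u \notin L -> apart h [:: u] L by move=> ?; apply: apart_fresh.
have hfa a b h0 c0 : f != a -> f != b -> (forall z, ~~ drawn h0 f z) ->
    (forall z, ~~ drawn (add_edge h0 a b c0) f z).
  by move=> fa fb H z; rewrite drawn_add (negbTE (H z)) (negbTE fa) (negbTE fb).
apply: (@forces_draw_color c _ _ _ y u) => //; first by rewrite eq_sym.
- by rewrite drawn_sym hu.
(* The edge yu is blue: [u] prolongs the blue path and the domino is kept. *)
- apply: (@forces_leq m); first exact: (leq_addl 2 m).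
  set h1 := add_edge _ _ _ _.
  suff g1 : growing h1 c (x :: R) [:: u, y & B] ((q, q') :: ds).
    by apply: (next _ _ _ _ g1 isT isT (leq_pred _)); clear; rewrite /=; lia.
  rewrite /h1; split.
  - by apply: ipath_add => //; notin.
  - rewrite ipath_cons; apply/and4P; split; first by [].
    + by rewrite colored_sym colored_add_new.
    + by apply: apart_add; notin; apply: ufresh.
    + by apply: ipath_add => //; notin.
  - rewrite apart_consr; apply/andP; split; apply: apart_add => //; try by notin.
    by rewrite apart_sym; apply: ufresh; notin.
  - rewrite dominoes_cons; apply/and3P; split.
    + by apply: ipath_add => //; notin.
    + by apply: apart_add => //; notin.
    + exact: dominoes_add.
  - split; first by apply: apart_add => //; notin.
    rewrite apart_consl; apply/andP; split; apply: apart_add => //; try by notin.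
    by apply: ufresh; notin.
apply: (@forces_draw_color c _ _ _ x q) => //.
- by rewrite drawn_add (negbTE (apart_ndrawn axq _ _)) ?inE //; notin.
- apply: (@forces_draw_color c _ _ _ x y) => //.
  + rewrite !drawn_add (negbTE (apart_ndrawn axy _ _)) ?inE //; notin.
  + set h3 := add_edge _ _ _ _.
    (* The edge xy is blue: [x] passes to the blue path together with the domino. The red neighbour
       of [x] would now be adjacent to the blue path and is given up. *)
    have g3 : growing h3 c (behead R) [:: q', q, x, y & B] ds.
      have bR : {subset behead R <= R} by move=> a /mem_behead.
      have nR a : a \notin R -> a \notin behead R by apply: contra => /bR.
      have [yR2 qR2] := (nR _ yR, nR _ qR).
      have [xR2 uR2] := (nR _ xR, nR _ uR).
      have q'R2 := nR _ q'R.
      have axR2 : apart h [:: x] (behead R).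
        by case: (R) iR => // r R' /=; case/andP=> /and3P[].
      have iR2 : ipath h (~~ c) (behead R).
        by case: (R) iR => // r R' /= /andP[_ /andP[]].
      have aR2 t : apart h R t -> apart h (behead R) t by apply: apart_sub.
      rewrite /h3; split.
      - by do 3![apply: ipath_add; try by notin].
      - rewrite !ipath_cons; apply/and4P; split; first by notin.
        + by rewrite !colored_add colored_sym cqq'.
        + do 3![apply: apart_add; try by notin].
          by rewrite apart_sym apart_consl axq' apart_consl ayq'.
        apply/and4P; split; first by notin.
        + by rewrite colored_add colored_sym colored_add_new.
        + do 3![apply: apart_add; try by notin].
          by rewrite apart_sym apart_consl ayq.
        apply/and4P; split; first by notin.
        + exact: colored_add_new.
        + by do 3![apply: apart_add; try by notin].
        + by do 3![apply: ipath_add; try by notin].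
      - do 3![apply: apart_add; try by notin].
        rewrite (apart_consr _ q') (apart_consr _ q) (apart_consr _ x) (apart_consr _ y).
        by apply/and5P; split; try exact: aR2; rewrite apart_sym.
      - by do 3![apply: dominoes_add; try by notin].
      - split; do 3![apply: apart_add; try by notin]; first exact: aR2.
        rewrite (apart_consl _ q') (apart_consl _ q) (apart_consl _ x).
        by rewrite (apart_consl _ y) aqds1 aqds2 axds ayds.
    have fB3 : f \notin [:: q', q, x, y & B] by notin.
    have hf3 : forall z, ~~ drawn h3 f z by rewrite /h3; do 3!apply: (hfa) => //; rewrite eq_sym.
    have [R' [gR' R'0 sR']] := growing_refillR fB3 fds hf3 g3.
    by apply: (next _ _ _ _ gR' R'0 isT (leqnn _)); move: R'0 sR'; clear;
      rewrite /= size_behead; lia.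
  + set h3 := add_edge _ _ _ _.
    (* The edge xy is red: [y] passes to the red path together with its red leaf [u]. The blue
       neighbour of [y] and the domino attached to [x] are given up. *)
    have g3 : growing h3 c [:: u, y, x & R] (behead B) ds.
      have bB : {subset behead B <= B} by move=> a /mem_behead.
      have nB a : a \notin B -> a \notin behead B by apply: contra => /bB.
      have [yB2 qB2] := (nB _ yB, nB _ qB).
      have [xB2 uB2] := (nB _ xB, nB _ uB).
      have ayB2 : apart h [:: y] (behead B).
        by case: (B) iB => // r B' /=; case/andP=> /and3P[].
      have iB2 : ipath h c (behead B).
        by case: (B) iB => // r B' /= /andP[_ /andP[]].
      have aB2 t : apart h B t -> apart h (behead B) t by apply: apart_sub.
      rewrite /h3; split.
      - rewrite !ipath_cons; apply/and4P; split; first by notin.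
        + by rewrite !colored_add !eqxx !orbT.
        + do 3![apply: apart_add; try by notin].
          by apply: ufresh; notin.
        apply/and4P; split; first by notin.
        + by rewrite colored_sym colored_add_new.
        + by do 3![apply: apart_add; try by notin]; rewrite apart_sym.
        + by do 3![apply: ipath_add; try by notin].
      - by do 3![apply: ipath_add; try by notin].
      - do 3![apply: apart_add; try by notin].
        rewrite (apart_consl _ u) (apart_consl _ y) (apart_consl _ x).
        apply/and4P; split=> //; first exact: ufresh.
          by rewrite apart_sym aB2 // apart_sym.
        by rewrite apart_sym aB2 // apart_sym.
      - by do 3![apply: dominoes_add; try by notin].
      - split; do 3![apply: apart_add; try by notin]; last exact: aB2.
        by rewrite (apart_consl _ u) (apart_consl _ y) (apart_consl _ x)
          ufresh // ayds axds.
    have fR3 : f \notin [:: u, y, x & R] by rewrite eq_sym in uf; notin.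
    have hf3 : forall z, ~~ drawn h3 f z by rewrite /h3; do 3!apply: (hfa) => //; rewrite eq_sym.
    have [B' [gB' B'0 sB']] := growing_refillB fR3 fds hf3 g3.
    by apply: (next _ _ _ _ gB' isT B'0 (leqnn _)); move: B'0 sB'; clear;
      rewrite /= size_behead; lia.
(* The edge xq is red: [q] prolongs the red path and the domino is spent. *)
- apply: (@forces_leq m); first exact: (leq_addl 1 m).
  set h2 := add_edge _ _ _ _.
  suff g2 : growing h2 c [:: q, x & R] (y :: B) ds.
    by apply: (next _ _ _ _ g2 isT isT (leqnn _)); clear; rewrite /=; lia.
  rewrite /h2; split.
  - rewrite ipath_cons; apply/and4P; split; first by rewrite eq_sym.
    + by rewrite colored_sym colored_add_new.
    + by do 2![apply: apart_add; try by notin]; rewrite apart_sym.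
    + by do 2![apply: ipath_add; try by notin].
  - by do 2![apply: ipath_add; try by notin].
  - rewrite apart_consl; apply/andP; split; do 2![apply: apart_add; try by notin] => //.
    by rewrite apart_sym apart_consl ayq.
  - by do 2![apply: dominoes_add; try by notin].
  - split; last by do 2![apply: apart_add; try by notin]; rewrite apart_consl ayds.
    rewrite apart_consl; apply/andP; split; do 2![apply: apart_add; try by notin] => //.
    by rewrite apart_consl axds.
Qed.

(** The weight 5|R| + 4|B| starts at 9 and gains 2 per step. After j = [uphalf (9 * L)] steps it is
    at least 9L, which forces |R| or |B| to be at least L. A step uses at most one domino, so 2j
    rounds for dominoes and 3j for steps suffice. *)
Lemma forces_path m G L h : 0 < L ->
  (forall h' c s, size s = L -> ipath h' c s -> forces m G h') ->
  forces (5 * uphalf (9 * L) + m) G h.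
Proof.
move=> L0 GL; set j := uphalf _.
have grow i h' c R B ds : growing h' c R B ds -> 0 < size R -> 0 < size B ->
    i <= size ds -> 9 * L <= 5 * size R + 4 * size B + 2 * i ->
    forces (3 * i + m) G h'.
  elim: i h' R B ds => [|i IH] h' R B ds gr R0 B0 ids le.
    case: gr => iR iB _ _ _.
    have [LR|LB] : L <= size R \/ L <= size B by lia.
      apply: (GL _ (~~ c) (take L R)); first by rewrite size_takel.
      by apply: (@ipath_catl _ _ _ (drop L R)); rewrite cat_take_drop.
    apply: (GL _ c (take L B)); first by rewrite size_takel.
    by apply: (@ipath_catl _ _ _ (drop L B)); rewrite cat_take_drop.
  rewrite mulnS -addnA; apply: (growing_step R0 B0 _ gr); first by lia.
  by move=> h2 R2 B2 ds2 gr2 R20 B20 ds2s le2; apply: (IH _ _ _ _ gr2); lia.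
have -> : 5 * j + m = 2 * j + (3 * j + m) by lia.
apply: forces_dominoes => h' c ds ds_j dds.
have [x xn hx] := fresh_vertex h' (flat ds).
have [y yn hy] := fresh_vertex h' (x :: flat ds).
move: yn; rewrite in_cons negb_or => /andP[yx yds].
have g0 : growing h' c [:: x] [:: y] ds; last first.
  by apply: (grow _ _ _ _ _ _ g0 isT isT); rewrite ?ds_j // /j /=; lia.
split=> //; last by split; apply: apart_fresh.
by apply: apart_fresh => //; rewrite inE eq_sym.
Qed.

(** * Forcing an even cycle from a long path *)

Ltac alia := repeat match goal with
  | H : is_true (ipath _ _ _) |- _ => clear H
  | H : is_true (apart _ _ _) |- _ => clear H
  | H : is_true (colored _ _ _ _) |- _ => clear H
  | H : is_true (drawn _ _ _) |- _ => clear H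
  | H : is_true (~~ drawn _ _ _) |- _ => clear H
  | H : is_true (_ \in _) |- _ => clear H
  | H : is_true (_ \notin _) |- _ => clear H
  | H : is_true (~~ (?U _)) |- _ => is_var U; clear H
  | H : is_true (?U _) |- _ => is_var U; clear H
  | H : _ /\ _ |- _ => clear H
  | H : forall _ : nat, _ |- _ => clear H
  end; lia.

(** Records where edges were added: tests of vertices in [X] against a column [F]. Induced paths
    that avoid [F] survive whatever the answers are. *)
Definition evolves (h h' : position) (X F : seq nat) : Prop :=
  {subset h <= h'} /\ forall x y, drawn h' x y ->
    [\/ drawn h x y, (x \in F) && (y \in X) | (x \in X) && (y \in F)].

Lemma evolves_refl h X F : evolves h h X F.
Proof. by split=> // x y; constructor 1. Qed.

Lemma evolves_add h h' X F a b c : evolves h h' X F -> a \in X -> b \in F ->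
  evolves h (add_edge h' a b c) X F.
Proof.
case=> sub dr aX bF; split=> [e he|x y]; first by apply/sub_add/sub.
rewrite drawn_add => /or3P[/dr //|/andP[/eqP-> /eqP->]|/andP[/eqP-> /eqP->]].
  by constructor 3; rewrite aX.
by constructor 2; rewrite aX bF.
Qed.

Lemma evolves_weak h h' X X' F : {subset X <= X'} ->
  evolves h h' X F -> evolves h h' X' F.
Proof.
move=> XX' [sub dr]; split=> // x y /dr[?|/andP[xF yX]|/andP[xX yF]].
- by constructor 1.
- by constructor 2; rewrite xF XX'.
- by constructor 3; rewrite yF XX'.
Qed.

Lemma evolves_trans h h' h'' X X' F : evolves h h' X F -> evolves h' h'' X' F ->
  evolves h h'' (X ++ X') F.
Proof.
case=> sub dr [sub' dr']; split=> [e /sub/sub' //|x y].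
case/dr' => [/dr[?|/andP[xF yX]|/andP[xX yF]]|/andP[xF yX]|/andP[xX yF]].
- by constructor 1.
- by constructor 2; rewrite xF mem_cat yX.
- by constructor 3; rewrite yF mem_cat xX.
- by constructor 2; rewrite xF mem_cat yX orbT.
- by constructor 3; rewrite yF mem_cat xX orbT.
Qed.

Lemma evolves_old h h' X F x y : evolves h h' X F -> x \notin X -> x \notin F ->
  drawn h' x y -> drawn h x y.
Proof.
by case=> _ dr xX xF /dr[//||] /andP[]; rewrite ?(negbTE xX) ?(negbTE xF).
Qed.

Lemma evolves_oldF h h' X F x y : evolves h h' X F -> x \notin F -> y \notin F ->
  drawn h' x y -> drawn h x y.
Proof.
by case=> _ dr xF yF /dr[//||] /andP[]; rewrite ?(negbTE xF) ?(negbTE yF).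
Qed.

Lemma evolves_ipath h h' X F c s : evolves h h' X F ->
  (forall x, x \in s -> x \notin F) -> ipath h c s -> ipath h' c s.
Proof.
move=> ev sF; apply: ipath_mono => [|x y xs ys]; first by case: ev.
by apply: (evolves_oldF ev); apply: sF.
Qed.

Lemma evolves_apart h h' X F s t : evolves h h' X F ->
  (forall x, x \in s -> x \notin F) -> (forall x, x \in t -> x \notin F) ->
  apart h s t -> apart h' s t.
Proof.
move=> ev sF tF; apply: apart_mono => x y xs yt.
by apply: (evolves_oldF ev); [apply: sF|apply: tF].
Qed.

(** * Red paths that alternate between new vertices and a long blue path *)

Section EvenCycle.

Variables (d : nat) (v : nat -> nat) (c : bool).
Hypotheses (d_gt1 : 1 < d) (d_even : ~~ odd d).

(** Six blocks of 4d positions serve to grow the red paths; the two closing columns sit at {24d,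
    26d} and {26d + 2, 28d + 2}. *)
Local Notation L := (28 * d + 3).
Local Notation red := (~~ c).

Let G (h : position) : Prop :=
  loopless h -> mono_induced_copy (cycle_graph (2 * d + 2)) h.

Definition blue_path (h : position) : Prop := forall i j, i < j < L ->
  v i != v j /\ if j == i.+1 then colored h c (v i) (v j)
                else ~~ drawn h (v i) (v j).

Definition offpath (y : nat) : Prop := forall j, j < L -> y != v j.

(* U is the set of positions at which the red paths may touch the blue path. *)
Definition isW (h : position) (U : pred nat) (y : nat) : Prop :=
  offpath y /\ forall j, j < L -> drawn h y (v j) -> U j.

Definition isV (U : pred nat) (y : nat) : Prop :=
  exists j, [/\ j < L, U j & y = v j].

(** Odd indices carry column vertices and even indices new ones, so the vertex called a_i above is
    [nth 0 A (2 * i)]. *)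
Definition alternating (h : position) (U : pred nat) (s : seq nat) : Prop :=
  forall k, k < size s ->
    if odd k then isV U (nth 0 s k) else isW h U (nth 0 s k).

(** Even positions are never consecutive on the blue path, so it does not join two column
    vertices. *)
Definition evens (U : pred nat) : Prop := forall j, U j -> ~~ odd j.

Lemma v_inj h i j : blue_path h -> i < L -> j < L -> (v i == v j) = (i == j).
Proof.
move=> vp iL jL; apply/eqP/eqP => [E|-> //]; case: (ltngtP i j) => // ij.
  by have [] := vp i j (introT andP (conj ij jL)); rewrite E eqxx.
by have [] := vp j i (introT andP (conj ij iL)); rewrite E eqxx.
Qed.

Lemma blue_path_ndrawn h i j : blue_path h -> i < L -> j < L -> i.+1 < j ->
  ~~ drawn h (v i) (v j).
Proof.
move=> vp iL jL ij; have ij' : i < j < L by rewrite jL andbT ltnW.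
have [_] := vp i j ij'; case: ifP => // /eqP E.
by rewrite E ltnn in ij.
Qed.

Lemma blue_path_evolves h h' X F : evolves h h' X F ->
  (forall x, x \in X -> offpath x) -> blue_path h -> blue_path h'.
Proof.
move=> ev Xoff vp i j /andP[ij jL]; have [ne H] := vp i j (introT andP (conj ij jL)).
split=> //; move: H; case: ifP => _.
  by apply: colored_sub; case: ev.
apply: contra; case: ev => _ dr /dr[//||] /andP[A B].
  by have := Xoff _ B _ jL; rewrite eqxx.
by have := Xoff _ A _ (ltn_trans ij jL); rewrite eqxx.
Qed.

Lemma cycle_win h col x s : size s = 2 * d + 1 -> ipath h col s ->
  (forall i, i < size s -> x != nth 0 s i /\
    if (i == 0) || (i == 2 * d) then colored h col x (nth 0 s i)
    else ~~ drawn h x (nth 0 s i)) -> G h.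
Proof.
move=> ss is_ xs lh; have -> : 2 * d + 2 = (size s).+1 by rewrite ss; lia.
apply: (ipath_cycle_copy (x := x) lh is_) => i iN; have [ne H] := xs i iN; split=> //.
by have -> : (size s).-1 = 2 * d by rewrite ss; lia.
Qed.

Lemma blue_win h y t : blue_path h -> t + 2 * d < L -> offpath y ->
  (forall j, t < j < t + 2 * d -> ~~ drawn h y (v j)) ->
  colored h c y (v t) -> colored h c y (v (t + 2 * d)) -> G h.
Proof.
move=> vp tL yoff yin y0 y1.
apply: (@cycle_win h c y [seq v i | i <- iota t (2 * d + 1)]).
- by rewrite size_map size_iota.
- apply/ipathP => i j; rewrite size_map size_iota => /andP[ij jN].
  have iN : i < 2 * d + 1 by apply: ltn_trans jN.
  rewrite !(nth_map 0) ?size_iota // !nth_iota //.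
  have ijL : t + i < t + j < L by lia.
  have [ne H] := vp _ _ ijL; split=> //.
  by move: H; rewrite -addnS eqn_add2l.
move=> i; rewrite size_map size_iota => iN.
rewrite (nth_map 0) ?size_iota // nth_iota //; split; first by apply: yoff; lia.
have [->|i0] := eqVneq i 0; first by rewrite addn0.
by have [->|i1] := eqVneq i (2 * d) => //=; apply: yin; lia.
Qed.

Lemma isW_evolves h h' X t t' (U U' : pred nat) y : blue_path h ->
  evolves h h' X [:: v t; v t'] -> t < L -> t' < L ->
  subpred U U' -> U' t -> U' t' -> isW h U y -> isW h' U' y.
Proof.
move=> vp [_ dr] tL t'L UU' Ut Ut' [yoff yU]; split=> // j jL /dr[].
- by move/(yU _ jL)/UU'.
- by rewrite !inE (negbTE (yoff _ tL)) (negbTE (yoff _ t'L)).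
- by rewrite !inE !(v_inj vp) // => /andP[_ /orP[]/eqP->].
Qed.

Lemma alternating_evolves h h' X t t' (U U' : pred nat) s : blue_path h ->
  evolves h h' X [:: v t; v t'] -> t < L -> t' < L ->
  subpred U U' -> U' t -> U' t' -> alternating h U s -> alternating h' U' s.
Proof.
move=> vp ev tL t'L UU' Ut Ut' alt k kN; have := alt k kN; case: ifP => _.
  by case=> j [jL Uj ->]; exists j; split=> //; apply: UU'.
exact: isW_evolves ev tL t'L UU' Ut Ut'.
Qed.

Lemma alternating_clean h (U : pred nat) s y t : blue_path h -> evens U ->
  alternating h U s -> y \in s -> t < L -> ~~ odd t -> ~~ U t ->
  y != v t /\ ~~ drawn h y (v t).
Proof.
move=> vp Uev alt /(nthP 0)[k kN <-] tL t_even Ut.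
have := alt k kN; case: ifP => _; last first.
  by case=> yoff yU; split; [apply: yoff|apply: contra Ut; apply: yU].
case=> j [jL Uj ->]; rewrite (v_inj vp) //.
have jt : j != t by apply: contraNneq Ut => <-.
split=> //; case: (ltngtP j t) jt => // jt _.
  by apply: blue_path_ndrawn => //; have := Uev j Uj; lia.
by rewrite drawn_sym; apply: blue_path_ndrawn => //; have := Uev j Uj; lia.
Qed.

Lemma alternating_rev h U s : odd (size s) -> alternating h U s ->
  alternating h U (rev s).
Proof.
move=> os alt k; rewrite size_rev => kN; rewrite nth_rev //.
have k'N : size s - k.+1 < size s by lia.
by have := alt _ k'N; have -> : odd (size s - k.+1) = odd k by lia.
Qed.

Lemma alternating_head h U s : 0 < size s -> alternating h U s -> isW h U (head 0 s).
Proof. by move=> s0 alt; have := alt 0 s0; rewrite nth0. Qed.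

Lemma alternating_last h U s : odd (size s) -> alternating h U s -> isW h U (last 0 s).
Proof.
move=> os alt; have := alt (size s).-1; rewrite nth_last.
have -> : odd (size s).-1 = false by lia.
by apply; lia.
Qed.


(** Two blue answers close a blue cycle, as [y] has no neighbour between the rows. The boolean [e]
    names the row to which [y] is red; after a red answer at the first row the second edge is not
    drawn. *)
Lemma resolve m h y t : blue_path h -> t + 2 * d < L -> offpath y ->
  (forall j, t <= j <= t + 2 * d -> ~~ drawn h y (v j)) ->
  (forall h' (e : bool), evolves h h' [:: y] [:: v t; v (t + 2 * d)] ->
     colored h' red y (v (t + e * (2 * d))) -> forces m G h') ->
  forces (2 + m) G h.
Proof.
move=> vp tL yoff yn next; have tL' : t < L by lia.
have ev1 col : evolves h (add_edge h y (v t) col) [:: y] [:: v t; v (t + 2 * d)].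
  by apply: evolves_add (evolves_refl _ _ _) _ _; rewrite !inE eqxx.
have ev2 col col' : evolves h (add_edge (add_edge h y (v t) col) y (v (t + 2 * d)) col')
    [:: y] [:: v t; v (t + 2 * d)].
  by apply: evolves_add (ev1 _) _ _; rewrite !inE eqxx ?orbT.
have off1 x : x \in [:: y] -> offpath x by rewrite inE => /eqP->.
have t2 : (t + 2 * d == t) = false by lia.
apply: (@forces_draw_color c _ _ _ y (v t)); first exact: yoff.
- by apply: yn; lia.
- apply: (@forces_draw_color c _ _ _ y (v (t + 2 * d))); first exact: yoff.
  + rewrite drawn_add (negbTE (yn _ _)); last by lia.
    by rewrite (v_inj vp) // t2 (negbTE (yoff _ tL')) andbF.
  + apply: forces_now; apply: (@blue_win _ y t) => //.
    * exact: blue_path_evolves (ev2 _ _) off1 vp.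
    * move=> j /andP[tj jt]; have jL : j < L by lia.
      rewrite !drawn_add (negbTE (yn _ _)); last by lia.
      rewrite !(v_inj vp) // (negbTE (yoff _ tL')) (negbTE (yoff _ tL)) /=; lia.
    * by rewrite colored_add colored_add_new.
    * exact: colored_add_new.
  + by apply: (next _ true) => //; rewrite mul1n colored_add_new.
apply: (@forces_leq m) => //.
by apply: (next _ false) => //; rewrite mul0n addn0 colored_add_new.
Qed.

(** * Closing a red cycle on two red paths *)

Definition free_column (U : pred nat) (t t' : nat) : Prop :=
  [/\ t < L, t' < L, ~~ odd t, ~~ odd t' & ~~ U t && ~~ U t'].

Lemma alternating_notinF h U s t t' y : blue_path h -> evens U -> alternating h U s ->
  free_column U t t' -> y \in s -> y \notin [:: v t; v t'].
Proof.
move=> vp Uev alt [tL t'L te t'e /andP[Ut Ut']] ys.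
rewrite !inE negb_or; have [-> _] := alternating_clean vp Uev alt ys tL te Ut.
by have [-> _] := alternating_clean vp Uev alt ys t'L t'e Ut'.
Qed.

Lemma alternating_nadj h h' U s X t t' g y : blue_path h -> evens U ->
  alternating h U s -> free_column U t t' -> evolves h h' X [:: v t; v t'] ->
  g \in [:: t; t'] -> y \in s -> y \notin X -> v g != y /\ ~~ drawn h' (v g) y.
Proof.
move=> vp Uev alt fc ev gt ys yX; have yF := alternating_notinF vp Uev alt fc ys.
case: fc => tL t'L te t'e /andP[Ut Ut'].
have [gL ge Ug] : [/\ g < L, ~~ odd g & ~~ U g].
  by move: gt; rewrite !inE => /orP[]/eqP->.
have [ne nd] := alternating_clean vp Uev alt ys gL ge Ug.
rewrite eq_sym ne drawn_sym; split=> //; apply: contra nd.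
exact: evolves_old ev yX yF.
Qed.

(** The column vertex [v g] joins both ends of a red path on 2d + 1 vertices; the inner vertices
    were not tested on this column. *)
Lemma close_one h h' U A X t t' g : blue_path h -> evens U -> alternating h U A ->
  size A = 2 * d + 1 -> ipath h red A -> free_column U t t' ->
  evolves h h' X [:: v t; v t'] ->
  (forall k, 0 < k < 2 * d -> nth 0 A k \notin X) -> g \in [:: t; t'] ->
  colored h' red (head 0 A) (v g) -> colored h' red (last 0 A) (v g) -> G h'.
Proof.
move=> vp Uev alt sA iA fc ev nX gt cA lA.
have AF x : x \in A -> x \notin [:: v t; v t'] := alternating_notinF vp Uev alt fc.
apply: (@cycle_win h' red (v g) A) => //; first exact: evolves_ipath ev AF iA.
move=> i iN; have iA' : nth 0 A i \in A by apply: mem_nth.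
have ne : v g != nth 0 A i.
  case: fc => tL t'L te t'e /andP[Ut Ut'].
  rewrite eq_sym; move: gt; rewrite !inE => /orP[]/eqP->.
    by have [] := alternating_clean vp Uev alt iA' tL te Ut.
  by have [] := alternating_clean vp Uev alt iA' t'L t'e Ut'.
split=> //; have [->|i0] := eqVneq i 0; first by rewrite nth0 colored_sym.
have [->|i1] := eqVneq i (2 * d).
  have E : (size A).-1 = 2 * d by rewrite sA; lia.
  by rewrite /= colored_sym -E nth_last.
have kX : nth 0 A i \notin X by apply: nX; lia.
by have [] := alternating_nadj vp Uev alt fc ev gt iA' kX.
Qed.

Lemma ipath_consI h col x s : ipath h col s -> x \notin s ->
  (0 < size s -> colored h col x (head 0 s)) ->
  (forall k, 0 < k < size s -> ~~ drawn h x (nth 0 s k)) -> ipath h col (x :: s).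
Proof.
case: s => // y s is_ xs cxy nd; rewrite ipath_cons is_ cxy // andbT.
move: xs; rewrite in_cons negb_or => /andP[-> xs]; rewrite andTb.
apply/apartP => a b; rewrite inE => /eqP-> bs; split.
  by apply: contraNneq xs => ->.
by case/(nthP 0): bs => k kN <-; apply: (nd k.+1).
Qed.

(** The cycle runs from [v g] to a_(d/2 - 1), down to a_0, through [v g1] to the middle of B, and
    along B to its start and back to [v g]. It has 1 + (d - 1) + 1 + (d + 1) = 2d + 2 vertices. *)
Lemma close_two h h' U A B X g1 t t' g : blue_path h -> evens U ->
  alternating h U A -> alternating h U B ->
  size A = 2 * d + 1 -> size B = 2 * d + 1 ->
  ipath h red A -> ipath h red B -> apart h A B ->
  g1 < L -> U g1 -> v g1 \notin A -> v g1 \notin B ->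
  colored h red (v g1) (nth 0 A 0) -> colored h red (v g1) (nth 0 B d) ->
  (forall k, 0 < k < 2 * d -> ~~ drawn h (v g1) (nth 0 A k)) ->
  (forall k, k < 2 * d + 1 -> k != d -> ~~ drawn h (v g1) (nth 0 B k)) ->
  free_column U t t' -> evolves h h' X [:: v t; v t'] ->
  (forall x, x \in X -> offpath x) ->
  (forall k, k < d - 2 -> nth 0 A k \notin X) ->
  (forall k, 0 < k <= d -> nth 0 B k \notin X) -> g \in [:: t; t'] ->
  colored h' red (nth 0 A (d - 2)) (v g) -> colored h' red (nth 0 B 0) (v g) ->
  G h'.
Proof.
move=> vp Uev altA altB sA sB iA iB AB g1L Ug1 g1A g1B cA cB nA nB fc ev Xoff AX BX gt ca cb.
have AF x : x \in A -> x \notin [:: v t; v t'] := alternating_notinF vp Uev altA fc.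
have BF x : x \in B -> x \notin [:: v t; v t'] := alternating_notinF vp Uev altB fc.
have tA : {subset take (d - 1) A <= A} by move=> a /mem_take.
have tB : {subset take (d + 1) B <= B} by move=> a /mem_take.
have stA : size (take (d - 1) A) = d - 1 by rewrite size_takel // sA; alia.
have stB : size (take (d + 1) B) = d + 1 by rewrite size_takel // sB; alia.
have [gL ge Ug] : [/\ g < L, ~~ odd g & ~~ U g].
  by case: fc => tL t'L te t'e /andP[Ut Ut']; move: gt; rewrite !inE => /orP[]/eqP->.
have g1g : g1 != g by apply: contraNneq Ug => <-.
have g1F : v g1 \notin [:: v t; v t'].
  case: fc => tL t'L te t'e /andP[Ut Ut']; rewrite !inE !(v_inj vp) // negb_or.
  by apply/andP; split; [apply: contraNneq Ut|apply: contraNneq Ut'] => <-.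
pose s := rev (take (d - 1) A) ++ v g1 :: rev (take (d + 1) B).
have is_ : ipath h red s.
  apply: ipath_join.
  - apply: ipath_consI.
    + by apply: (@ipath_catl _ _ _ (drop (d - 1) A)); rewrite cat_take_drop.
    + by apply: contra g1A => /tA.
    + by rewrite stA -nth0 nth_take //; alia.
    + by move=> k; rewrite stA => kd; rewrite nth_take; [apply: nA; alia|alia].
  - apply: ipath_consI.
    + apply: ipath_rev.
      by apply: (@ipath_catl _ _ _ (drop (d + 1) B)); rewrite cat_take_drop.
    + by rewrite mem_rev; apply: contra g1B => /tB.
    + rewrite -nth0 size_rev stB nth_rev stB; last by alia.
      have E : d + 1 - 1 = d by alia.
      by rewrite E nth_take //; alia.
    + move=> k; rewrite size_rev stB => kd; rewrite nth_rev stB; last by alia.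
      by rewrite nth_take; [apply: nB; alia|alia].
  - by apply: apart_sub AB => // a; rewrite mem_rev => /tB.
apply: (@cycle_win h' red (v g) s).
- by rewrite /s size_cat /= !size_rev stA stB; alia.
- apply: evolves_ipath ev _ is_ => x; rewrite mem_cat in_cons !mem_rev.
  by case/or3P=> [/tA/AF|/eqP->|/tB/BF].
move=> i; rewrite /s size_cat /= !size_rev stA stB => iN.
rewrite nth_cat size_rev stA; case: ltnP => id1.
  rewrite nth_rev stA // nth_take; last by alia.
  have kA : nth 0 A (d - 1 - i.+1) \in A by apply: mem_nth; rewrite sA; alia.
  have [i0|i0] := eqVneq i 0.
    rewrite i0 /=; have -> : d - 1 - 1 = d - 2 by alia.
    rewrite colored_sym ca; split=> //.
    have k0A : nth 0 A (d - 2) \in A by apply: mem_nth; rewrite sA; alia.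
    by rewrite eq_sym; have [] := alternating_clean vp Uev altA k0A gL ge Ug.
  have -> : (i == 2 * d) = false by alia.
  by apply: (alternating_nadj vp Uev altA fc ev gt kA); apply: AX; alia.
have [->|id2] := eqVneq i (d - 1).
  rewrite subnn /=; have -> : (d - 1 == 0) = false by alia.
  have -> : (d - 1 == 2 * d) = false by alia.
  rewrite (v_inj vp) // eq_sym; split=> //.
  have g1e := Uev _ Ug1.
  have vp' := blue_path_evolves ev Xoff vp.
  case: (ltngtP g1 g) g1g => // gg _; last by apply: (blue_path_ndrawn vp') => //; alia.
  by rewrite drawn_sym; apply: (blue_path_ndrawn vp') => //; alia.
have -> : i - (d - 1) = (i - d).+1 by alia.
rewrite /= nth_rev stB; last by alia.
rewrite nth_take; last by alia.
have kB : nth 0 B (d + 1 - (i - d).+1) \in B by apply: mem_nth; rewrite sB; alia.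
have -> : (i == 0) = false by alia.
have [i2|i2] := eqVneq i (2 * d).
  rewrite /=; move: kB; have -> : d + 1 - (i - d).+1 = 0 by alia.
  move=> kB; rewrite colored_sym cb; split=> //.
  by rewrite eq_sym; have [] := alternating_clean vp Uev altB kB gL ge Ug.
by apply: (alternating_nadj vp Uev altB fc ev gt kB); apply: BX; alia.
Qed.

Definition red_pair (h : position) (U : pred nat) (A B : seq nat) : Prop :=
  [/\ alternating h U A, alternating h U B,
      (size A = 2 * d + 1 /\ size B = 2 * d + 1),
      (ipath h red A /\ ipath h red B) & apart h A B].

Lemma red_pair_sym h U A B : red_pair h U A B -> red_pair h U B A.
Proof. by case=> aA aB [sA sB] [iA iB] AB; split=> //; rewrite apart_sym. Qed.

Lemma red_pair_rev h U A B : red_pair h U A B -> red_pair h U A (rev B).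
Proof.
case=> aA aB [sA sB] [iA iB] AB; split=> //.
- by apply: alternating_rev => //; rewrite sB; lia.
- by rewrite size_rev.
- by split=> //; apply: ipath_rev.
- by apply: apart_sub AB => // x; rewrite mem_rev.
Qed.

Lemma red_pair_evolves h h' (U U' : pred nat) A B X t t' : blue_path h -> evens U ->
  free_column U t t' -> evolves h h' X [:: v t; v t'] -> subpred U U' ->
  U' t -> U' t' -> red_pair h U A B -> red_pair h' U' A B.
Proof.
move=> vp Uev fc ev UU' Ut Ut' [aA aB ss [iA iB] AB].
have AF x : x \in A -> x \notin [:: v t; v t'] := alternating_notinF vp Uev aA fc.
have BF x : x \in B -> x \notin [:: v t; v t'] := alternating_notinF vp Uev aB fc.
case: fc => tL t'L _ _ _; split=> //.
- exact: alternating_evolves ev tL t'L UU' Ut Ut' aA.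
- exact: alternating_evolves ev tL t'L UU' Ut Ut' aB.
- by split; [apply: evolves_ipath ev AF iA|apply: evolves_ipath ev BF iB].
- exact: evolves_apart ev AF BF AB.
Qed.

(** The state after the first closing column: [v g] joins the start of A to the middle of B. An edge
    from [v g] to the last vertex of A is allowed, as the final cycle avoids that vertex. *)
Definition bridged (h : position) (U : pred nat) (A B : seq nat) (g : nat) : Prop :=
  [/\ [/\ g < L, U g, v g \notin A & v g \notin B],
      colored h red (v g) (nth 0 A 0), colored h red (v g) (nth 0 B d),
      forall k, 0 < k < 2 * d -> ~~ drawn h (v g) (nth 0 A k)
    & forall k, k < 2 * d + 1 -> k != d -> ~~ drawn h (v g) (nth 0 B k)].

(** Reversal fixes the middle index d, so either end of B may serve as its start. *)
Lemma bridged_rev h U A B g : size B = 2 * d + 1 ->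
  bridged h U A B g -> bridged h U A (rev B) g.
Proof.
move=> sB [[gL Ug gA gB] cA cB nA nB]; split=> //.
- by split=> //; rewrite mem_rev.
- by rewrite nth_rev sB; [have -> : 2 * d + 1 - d.+1 = d by lia|lia].
- by move=> k kN kd; rewrite nth_rev sB //; apply: nB; lia.
Qed.

Lemma close_bridged h h' U A B X g1 t t' g : blue_path h -> evens U ->
  red_pair h U A B -> bridged h U A B g1 -> free_column U t t' ->
  evolves h h' X [:: v t; v t'] ->
  {subset X <= [:: nth 0 B 0; nth 0 B (2 * d); nth 0 A (d - 2)]} ->
  g \in [:: t; t'] ->
  colored h' red (nth 0 A (d - 2)) (v g) -> colored h' red (nth 0 B 0) (v g) ->
  G h'.
Proof.
move=> vp Uev [altA altB [sA sB] [iA iB] AB] [[g1L Ug1 g1A g1B] cA cB nA nB] fc ev XX gt ca cb.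
have uA := ipath_uniq iA; have uB := ipath_uniq iB.
have A_in k : k < 2 * d + 1 -> nth 0 A k \in A by move=> kN; apply: mem_nth; rewrite sA.
have B_in k : k < 2 * d + 1 -> nth 0 B k \in B by move=> kN; apply: mem_nth; rewrite sB.
have ABn k l : k < 2 * d + 1 -> l < 2 * d + 1 -> (nth 0 A k == nth 0 B l) = false.
  by move=> kN lN; apply/negbTE; apply: (apart_neq AB); [apply: A_in|apply: B_in].
apply: (close_two vp Uev altA altB sA sB iA iB AB g1L Ug1 g1A g1B cA cB nA nB fc ev _ _ _ gt ca cb).
- have offW s' k : alternating h U s' -> k < size s' -> ~~ odd k -> offpath (nth 0 s' k).
    by move=> alt kN ke; have := alt k kN; rewrite (negbTE ke) => -[].
  move=> x /XX; rewrite !inE => /or3P[]/eqP->; apply: (offW) => //; rewrite ?sA ?sB; clear - d_gt1 d_even; lia.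
- move=> k kd; apply: contra (_ : nth 0 A k \notin _) => [/XX|]; first by apply.
  rewrite !inE !ABn; try by clear - kd; lia.
  rewrite nth_uniq ?sA //; clear - kd; lia.
- move=> k kd; apply: contra (_ : nth 0 B k \notin _) => [/XX|]; first by apply.
  rewrite !inE [_ == nth 0 A _]eq_sym ABn; try by clear - kd d_gt1; lia.
  rewrite !nth_uniq ?sB //; clear - kd d_gt1; lia.
Qed.

(** Three tests on the last column. If the ends of B agree, B closes up; otherwise a_(d/2 - 1)
    agrees with one of them, and reversing B makes it the first. *)
Lemma closing_bridged h U A B g1 : blue_path h -> evens U ->
  (forall j, U j -> j < 26 * d + 2) -> red_pair h U A B -> bridged h U A B g1 ->
  forces 6 G h.
Proof.
move=> vp Uev Ult pair br; have [altA altB [sA sB] [iA iB] AB] := pair.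
pose t := 26 * d + 2; pose t' := t + 2 * d.
have tL : t + 2 * d < L by rewrite /t; lia.
have U0 j : t <= j -> ~~ U j by move=> tj; apply/negP => /Ult; move: tj; rewrite /t; lia.
have fc : free_column U t t'.
  by split; rewrite ?U0 /t' /t //; lia.
have B0 : isW h U (nth 0 B 0) by rewrite nth0; apply: alternating_head => //; rewrite sB addn1.
have Bd : isW h U (nth 0 B (2 * d)).
  have -> : 2 * d = (size B).-1 by rewrite sB; lia.
  by rewrite nth_last; apply: alternating_last => //; rewrite sB; lia.
have Ad : isW h U (nth 0 A (d - 2)).
  have := altA (d - 2); rewrite sA; have -> : odd (d - 2) = false by lia.
  by apply; lia.
have WF y : isW h U y -> y \notin [:: v t; v t'].
  by case=> yoff _; rewrite !inE negb_or !yoff // /t'; lia.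
have Wn h' X y : isW h U y -> evolves h h' X [:: v t; v t'] -> y \notin X ->
    forall j, t <= j <= t + 2 * d -> ~~ drawn h' y (v j).
  move=> Wy ev yX j /andP[tj jt]; apply/negP => /(evolves_old ev yX (WF _ Wy)).
  case: Wy => _ yU /yU Uj; have : U j by apply: Uj; move: jt tL; rewrite /t; lia.
  exact/negP/U0.
have ABn k l : k < 2 * d + 1 -> l < 2 * d + 1 -> (nth 0 A k == nth 0 B l) = false.
  by move=> kN lN; apply/negbTE; apply: (apart_neq AB); apply: mem_nth; rewrite ?sA ?sB.
have X1off : forall x, x \in [:: nth 0 B 0] -> offpath x.
  by move=> x; rewrite inE => /eqP->; case: B0.
have X2off : forall x, x \in [:: nth 0 B 0; nth 0 B (2 * d)] -> offpath x.
  by move=> x; rewrite !inE => /orP[]/eqP->; [case: B0|case: Bd].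
apply: (@resolve 4 h (nth 0 B 0) t) => //; first by case: B0.
  by apply: Wn (evolves_refl _ [::] _) _.
move=> h1 e1 ev1 c1; have vp1 := blue_path_evolves ev1 X1off vp.
apply: (@resolve 2 h1 (nth 0 B (2 * d)) t) => //; first by case: Bd.
  apply: Wn ev1 _ => //; rewrite inE nth_uniq ?sB ?(ipath_uniq iB) //; clear - d_gt1; lia.
move=> h2 e2 ev2 c2; have ev12 := evolves_trans ev1 ev2.
have vp2 := blue_path_evolves ev12 X2off vp.
have gt (e : bool) : t + e * (2 * d) \in [:: t; t'].
  by case: e; rewrite !inE ?mul1n ?mul0n ?addn0 eqxx ?orbT.
have [e12|e12] := eqVneq e1 e2.
  apply: forces_now; apply: (close_one vp Uev altB sB iB fc ev12 _ (gt e1)).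
  - move=> k kd; rewrite !inE !nth_uniq ?sB ?(ipath_uniq iB) //; clear - kd d_gt1; lia.
  - by rewrite -nth0; apply: colored_sub c1; case: ev2.
  - by rewrite -nth_last sB addn1 e12.
apply: (@resolve 0 h2 (nth 0 A (d - 2)) t) => //; first by case: Ad.
  by apply: Wn ev12 _ => //; rewrite !inE !ABn //; clear - d_gt1; lia.
move=> h3 e3 ev3 c3; apply: forces_now; have ev := evolves_trans ev12 ev3.
have [sub23 sub13] : {subset h2 <= h3} /\ {subset h1 <= h3}.
  by case: ev3 => s3 _; case: ev2 => s2 _; split=> // x /s2/s3.
have [e31|e32] : e3 = e1 \/ e3 = e2 by case: (e1) (e2) (e3) e12 => [] [] []; auto.
  apply: (close_bridged vp Uev pair br fc ev _ (gt e1)) => //.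
    by rewrite -e31.
  exact: colored_sub c1.
apply: (close_bridged vp Uev (red_pair_rev pair) (bridged_rev sB br) fc ev _ (gt e2)).
- move=> x; rewrite !nth_rev sB; try by clear - d_gt1; lia.
  rewrite !inE; have -> : 2 * d + 1 - 1 = 2 * d by clear; lia.
  have -> : 2 * d + 1 - (2 * d).+1 = 0 by clear; lia.
  by case/or3P=> ->; rewrite ?orbT.
- by rewrite -e32.
- rewrite nth_rev sB; last by clear; lia.
  have -> : 2 * d + 1 - 1 = 2 * d by clear; lia.
  exact: colored_sub c2.
Qed.

(** The ends of A and the middle of B are tested on a column beyond all blocks. If the ends
    disagree, the middle of B agrees with one of them, and up to reversing A the column vertex is a
    bridge. *)
Lemma closing h U A B : blue_path h -> evens U -> (forall j, U j -> j < 24 * d) ->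
  red_pair h U A B -> forces 12 G h.
Proof.
move=> vp Uev Ult pair; have [altA altB [sA sB] [iA iB] AB] := pair.
pose t := 24 * d; pose t' := t + 2 * d.
have tL : t + 2 * d < L by rewrite /t; lia.
have U0 j : t <= j -> ~~ U j by move=> tj; apply/negP => /Ult; move: tj; rewrite /t; lia.
have fc : free_column U t t'.
  by split; rewrite ?U0 /t' /t //; lia.
have A0 : isW h U (nth 0 A 0) by rewrite nth0; apply: alternating_head => //; rewrite sA addn1.
have Ad : isW h U (nth 0 A (2 * d)).
  have -> : 2 * d = (size A).-1 by rewrite sA; lia.
  by rewrite nth_last; apply: alternating_last => //; rewrite sA; lia.
have Bd : isW h U (nth 0 B d).
  have := altB d; rewrite sB (negbTE d_even).
  by apply; lia.
have WF y : isW h U y -> y \notin [:: v t; v t'].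
  by case=> yoff _; rewrite !inE negb_or !yoff // /t'; lia.
have Wn h' X y : isW h U y -> evolves h h' X [:: v t; v t'] -> y \notin X ->
    forall j, t <= j <= t + 2 * d -> ~~ drawn h' y (v j).
  move=> Wy ev yX j /andP[tj jt]; apply/negP => /(evolves_old ev yX (WF _ Wy)).
  case: Wy => _ yU /yU Uj; have : U j by apply: Uj; move: jt tL; rewrite /t; lia.
  exact/negP/U0.
have uA := ipath_uniq iA; have uB := ipath_uniq iB.
have ABn k l : k < 2 * d + 1 -> l < 2 * d + 1 -> (nth 0 A k == nth 0 B l) = false.
  by move=> kN lN; apply/negbTE; apply: (apart_neq AB); apply: mem_nth; rewrite ?sA ?sB.
have X1off : forall x, x \in [:: nth 0 A 0] -> offpath x.
  by move=> x; rewrite inE => /eqP->; case: A0.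
have X2off : forall x, x \in [:: nth 0 A 0; nth 0 A (2 * d)] -> offpath x.
  by move=> x; rewrite !inE => /orP[]/eqP->; [case: A0|case: Ad].
have X3off : forall x, x \in [:: nth 0 A 0; nth 0 A (2 * d); nth 0 B d] -> offpath x.
  by move=> x; rewrite !inE => /or3P[]/eqP->; [case: A0|case: Ad|case: Bd].
apply: (@resolve 10 h (nth 0 A 0) t) => //; first by case: A0.
  by apply: Wn (evolves_refl _ [::] _) _.
move=> h1 e1 ev1 c1; have vp1 := blue_path_evolves ev1 X1off vp.
apply: (@resolve 8 h1 (nth 0 A (2 * d)) t) => //; first by case: Ad.
  apply: Wn ev1 _ => //; rewrite inE nth_uniq ?sA //; clear - d_gt1; lia.
move=> h2 e2 ev2 c2; have ev12 := evolves_trans ev1 ev2.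
have vp2 := blue_path_evolves ev12 X2off vp.
have gt (e : bool) : t + e * (2 * d) \in [:: t; t'].
  by case: e; rewrite !inE ?mul1n ?mul0n ?addn0 eqxx ?orbT.
have [e12|e12] := eqVneq e1 e2.
  apply: forces_now; apply: (close_one vp Uev altA sA iA fc ev12 _ (gt e1)).
  - move=> k kd; rewrite !inE !nth_uniq ?sA //; clear - kd d_gt1; lia.
  - by rewrite -nth0; apply: colored_sub c1; case: ev2.
  - by rewrite -nth_last sA addn1 e12.
apply: (@resolve 6 h2 (nth 0 B d) t) => //; first by case: Bd.
  by apply: Wn ev12 _ => //; rewrite !inE ![nth 0 B d == _]eq_sym !ABn //; clear - d_gt1; lia.
move=> h3 e3 ev3 c3; have ev := evolves_trans ev12 ev3.
have vp3 := blue_path_evolves ev X3off vp.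
have [sub23 sub13] : {subset h2 <= h3} /\ {subset h1 <= h3}.
  by case: ev3 => s3 _; case: ev2 => s2 _; split=> // x /s2/s3.
(* The red paths now also touch the blue path at this column, so its two positions are added to
   [U]. *)
pose U1 : pred nat := fun j => [|| U j, j == t | j == t'].
have UU1 : subpred U U1 by move=> j; rewrite /U1 => ->.
have U1t : U1 t by rewrite /U1 eqxx orbT.
have U1t' : U1 t' by rewrite /U1 eqxx !orbT.
have U1ev : evens U1.
  by move=> j /or3P[/Uev //|/eqP->|/eqP->]; rewrite /t' /t; clear; lia.
have U1lt j : U1 j -> j < 26 * d + 2.
  by case/or3P=> [/Ult|/eqP->|/eqP->]; rewrite /t' /t; clear - d_gt1; lia.
have pair1 := red_pair_evolves vp Uev fc ev UU1 U1t U1t' pair.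
have gU1 (e : bool) : U1 (t + e * (2 * d)).
  by move: (gt e); rewrite !inE => /orP[]/eqP->.
have gL (e : bool) : t + e * (2 * d) < L.
  by move: (gt e); rewrite !inE => /orP[]/eqP->; rewrite /t' /t; clear; lia.
have Fn (e : bool) y s : alternating h U s -> y \in s -> v (t + e * (2 * d)) != y.
  move=> alt ys; have := alternating_notinF vp Uev alt fc ys; rewrite !inE negb_or.
  case/andP=> n1 n2; rewrite eq_sym.
  by move: (gt e); rewrite !inE => /orP[]/eqP->.
have gA (e : bool) : v (t + e * (2 * d)) \notin A.
  by apply/negP => /(Fn e _ _ altA); rewrite eqxx.
have gB (e : bool) : v (t + e * (2 * d)) \notin B.
  by apply/negP => /(Fn e _ _ altB); rewrite eqxx.
have nA (e : bool) k : 0 < k < 2 * d -> ~~ drawn h3 (v (t + e * (2 * d))) (nth 0 A k).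
  move=> kd; have kA : nth 0 A k \in A by apply: mem_nth; rewrite sA; clear - kd; lia.
  suff kX : nth 0 A k \notin [:: nth 0 A 0; nth 0 A (2 * d); nth 0 B d].
    by have [] := alternating_nadj vp Uev altA fc ev (gt e) kA kX.
  rewrite !inE ABn; try by clear - kd; lia.
  rewrite !nth_uniq ?sA //; clear - kd; lia.
have nB (e : bool) k : k < 2 * d + 1 -> k != d ->
    ~~ drawn h3 (v (t + e * (2 * d))) (nth 0 B k).
  move=> kd kne; have kB : nth 0 B k \in B by apply: mem_nth; rewrite sB.
  suff kX : nth 0 B k \notin [:: nth 0 A 0; nth 0 A (2 * d); nth 0 B d].
    by have [] := alternating_nadj vp Uev altB fc ev (gt e) kB kX.
  rewrite !inE [_ == nth 0 A 0]eq_sym [_ == nth 0 A _]eq_sym !ABn //; try by clear - kd; lia.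
  rewrite !nth_uniq ?sB //; clear - kd kne; lia.
have [e31|e32] : e3 = e1 \/ e3 = e2 by case: (e1) (e2) (e3) e12 => [] [] []; auto.
  apply: (closing_bridged vp3 U1ev U1lt pair1 (g1 := t + e1 * (2 * d))).
  split=> //.
  - by rewrite colored_sym; apply: colored_sub c1.
  - by rewrite -e31 colored_sym.
  - exact: nA.
  - exact: nB.
apply: (closing_bridged vp3 U1ev U1lt (A := rev A) (B := B) (g1 := t + e2 * (2 * d))).
  exact/red_pair_sym/red_pair_rev/red_pair_sym.
split=> //.
- by split=> //; rewrite mem_rev.
- rewrite nth_rev sA; last by clear; lia.
  have -> : 2 * d + 1 - 1 = 2 * d by clear; lia.
  by rewrite colored_sym; apply: colored_sub c2.
- by rewrite -e32 colored_sym.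
- move=> k kd; rewrite nth_rev sA; last by clear - kd; lia.
  by apply: nA; clear - kd; lia.
- exact: nB.
Qed.

(** * Blocks of columns and two growing red paths *)

Definition valid_column (p : nat * nat) : bool := (p.1 < 6) && (p.2 < d).

(* Column (b, s) consists of the vertices [v t] and [v (t + 2 * d)] with
   t = 4db + 2s; both lie in block b, the positions from 4db to 4d(b+1) - 1. *)
Definition column (p : nat * nat) : nat := 4 * d * p.1 + 2 * p.2.

Definition in_columns (used : seq (nat * nat)) : pred nat :=
  fun j => has (fun p => (j == column p) || (j == column p + 2 * d)) used.

Lemma column_block p j : p.2 < d -> column p <= j <= column p + 2 * d ->
  j %/ (4 * d) = p.1.
Proof.
rewrite /column => pd jp.
have -> : j = p.1 * (4 * d) + (j - 4 * d * p.1) by rewrite mulnC; lia.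
by rewrite divnMDl ?divn_small ?addn0 //; lia.
Qed.

Lemma in_columns_even used : evens (in_columns used).
Proof.
move=> j /hasP[p _]; rewrite /column => /orP[]/eqP->; rewrite -!mulnA; lia.
Qed.

Lemma valid_column_lt p : valid_column p -> column p + 2 * d < 24 * d.
Proof.
case: p => b s /andP[/= b6 sd]; rewrite /column /=.
have : d * b <= d * 5 by rewrite leq_mul2l; lia.
by rewrite -mulnA; lia.
Qed.

Lemma in_columns_lt used j : all valid_column used -> in_columns used j -> j < 24 * d.
Proof.
move=> /allP au /hasP[p /au/valid_column_lt pd /orP[]/eqP->] //.
exact: leq_ltn_trans (leq_addr _ _) pd.
Qed.

(** Within a block the first rows have even offsets below 2d and the second rows even offsets from
    2d on, so different columns of a block are disjoint. *)
Lemma free_column_new (used : seq (nat * nat)) (p : nat * nat) : all valid_column used -> valid_column p ->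
  p \notin used -> free_column (in_columns used) (column p) (column p + 2 * d).
Proof.
move=> /allP au vp pu; have lt := valid_column_lt vp; split.
- by move: lt; lia.
- by move: lt; lia.
- by rewrite /column -!mulnA; lia.
- by rewrite /column -!mulnA; lia.
have {vp} pd : p.2 < d by case/andP: vp.
have neq (q : nat * nat) : q \in used -> p.1 = q.1 -> p.2 <> q.2 :> nat.
  case: p q pu {pd lt} => [a b] [a' b'] /negP pu qu /= E E'; apply: pu.
  by rewrite E E'.
have block (q : nat * nat) j : q \in used -> column p <= j <= column p + 2 * d ->
    column q <= j <= column q + 2 * d -> p.1 = q.1.
  move=> /au/andP[_ qd] jp jq.
  by rewrite -(column_block pd jp) (column_block qd jq).
apply/andP; split; apply/hasPn => q qu; have /andP[_ qd] := au q qu;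
  apply/negP => /orP[]/eqP E.
- have Eb : p.1 = q.1 by apply: (block q (column p)) => //; lia.
  by have := neq q qu Eb; move: E; rewrite /column Eb; move: (4 * d * q.1); clear; lia.
- have Eb : p.1 = q.1 by apply: (block q (column p)) => //; lia.
  by move: E pd; rewrite /column Eb; move: (4 * d * q.1); clear; lia.
- have Eb : p.1 = q.1 by apply: (block q (column p + 2 * d)) => //; lia.
  by move: E qd; rewrite /column Eb; move: (4 * d * q.1); clear; lia.
- have Eb : p.1 = q.1 by apply: (block q (column p + 2 * d)) => //; lia.
  by have := neq q qu Eb; move: E; rewrite /column Eb; move: (4 * d * q.1); clear; lia.
Qed.

(** Odd sizes make all ends new vertices, which can be tested. Each column used contributes one
    column vertex and one new vertex; this is the count in [tp_size]. *)
Record two_paths (h : position) (used : seq (nat * nat)) (P Q : seq nat) : Prop :=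
  TwoPaths {
    tp_blue : blue_path h;
    tp_used : all valid_column used;
    tp_altP : alternating h (in_columns used) P;
    tp_altQ : alternating h (in_columns used) Q;
    tp_pathP : ipath h red P;
    tp_pathQ : ipath h red Q;
    tp_apart : apart h P Q;
    tp_oddP : odd (size P);
    tp_oddQ : odd (size Q);
    tp_size : size P + size Q = 2 * size used + 2 }.

Lemma two_paths_sym h used P Q : two_paths h used P Q -> two_paths h used Q P.
Proof. by case=> *; split=> //; rewrite 1?apart_sym 1?addnC. Qed.

Definition column_moves (h h' : position) (used : seq (nat * nat)) (p : nat * nat)
    (X : seq nat) : Prop :=
  [/\ valid_column p, p \notin used,
      evolves h h' X [:: v (column p); v (column p + 2 * d)]
    & forall x, x \in X -> offpath x].

Definition fresh_for (h : position) (P Q : seq nat) (z : nat) : Prop :=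
  [/\ forall y, ~~ drawn h z y, z \notin P, z \notin Q & offpath z].

Lemma in_columns_new used p : [/\ subpred (in_columns used) (in_columns (p :: used)),
  in_columns (p :: used) (column p) & in_columns (p :: used) (column p + 2 * d)].
Proof. by split=> [j /=->||] /=; rewrite ?eqxx ?orbT. Qed.

(** Only heads have been tested, so [v g] meets P in its head alone, and by the last hypothesis it
    does not meet Q. *)
Lemma two_paths_extend h h' used P Q p X z g : two_paths h used P Q ->
  column_moves h h' used p X -> fresh_for h P Q z ->
  (forall y, y \in X -> y \in P -> y = head 0 P) ->
  (forall y, y \in X -> y \in Q -> y = head 0 Q) ->
  g \in [:: column p; column p + 2 * d] ->
  colored h' red (head 0 P) (v g) -> colored h' red z (v g) ->
  ~~ drawn h' (v g) (head 0 Q) ->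
  two_paths h' (p :: used) [:: z, v g & P] Q.
Proof.
case=> vp au altP altQ iP iQ PQ oP oQ sz [vcp pu ev Xoff] [hz zP zQ zoff] XP XQ gt cP cz nQ.
have fc := free_column_new au vcp pu; have Uev := @in_columns_even used.
have [UU Ut Ut'] := in_columns_new used p; have [tL t'L _ _ _] := fc.
have PF x : x \in P -> x \notin [:: v (column p); v (column p + 2 * d)] :=
  alternating_notinF vp Uev altP fc.
have QF x : x \in Q -> x \notin [:: v (column p); v (column p + 2 * d)] :=
  alternating_notinF vp Uev altQ fc.
have gL : g < L by move: gt; rewrite !inE => /orP[]/eqP->.
have gF : v g \in [:: v (column p); v (column p + 2 * d)].
  by move: gt; rewrite !inE => /orP[]/eqP->; rewrite eqxx ?orbT.
have zF : z \notin [:: v (column p); v (column p + 2 * d)].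
  by rewrite !inE negb_or !zoff.
have apz s : z \notin s -> (forall x, x \in s -> x \notin [:: v (column p); v (column p + 2 * d)]) ->
    apart h' [:: z] s.
  move=> zs sF; apply/apartP => a b; rewrite inE => /eqP-> bs; split.
    by apply: contraNneq zs => ->.
  by apply/negP => /(evolves_oldF ev zF (sF b bs)); rewrite (negbTE (hz b)).
split=> //.
- exact: blue_path_evolves ev Xoff vp.
- by rewrite /= vcp.
- have altP' := alternating_evolves vp ev tL t'L UU Ut Ut' altP.
  move=> [|[|k]] kN //=; last by rewrite negbK; apply: altP'.
  + apply: (isW_evolves vp ev tL t'L UU Ut Ut'); split=> // j jL.
    by rewrite (negbTE (hz _)).
  + by exists g; split=> //; move: gt; rewrite !inE => /orP[]/eqP->.
- exact: alternating_evolves ev tL t'L UU Ut Ut' altQ.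
- have g_head : 0 < size P by apply: odd_gt0.
  have ig : ipath h' red (v g :: P).
    apply: ipath_consI; first exact: evolves_ipath ev PF iP.
    + by apply/negP => /PF; rewrite gF.
    + by rewrite colored_sym.
    + move=> k /andP[k0 kN]; have kP : nth 0 P k \in P by apply: mem_nth.
      suff kX : nth 0 P k \notin X by have [] := alternating_nadj vp Uev altP fc ev gt kP kX.
      apply/negP => /XP /(_ kP) /eqP; rewrite -nth0 nth_uniq ?(ipath_uniq iP) //.
      by rewrite eqn0Ngt k0.
  by rewrite ipath_cons; apply/and4P; split=> //; [apply: zoff|apply: apz].
- exact: evolves_ipath ev QF iQ.
- rewrite (apart_consl _ z) (apart_consl _ (v g)) (apz Q) // andTb.
  apply/andP; split; last exact: evolves_apart ev PF QF PQ.
  apply/apartP => a b; rewrite inE => /eqP-> bQ; split.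
    by apply: contraTneq gF => ->; apply: QF.
  have [bX|bX] := boolP (b \in X); first by rewrite (XQ b bX bQ).
  by have [] := alternating_nadj vp Uev altQ fc ev gt bQ bX.
- by rewrite /= negbK.
- by move: sz; clear; rewrite /=; lia.
Qed.

(** The join leaves a single path, so a fresh vertex [q] starts another; the total again grows by
    two. *)
Lemma two_paths_join h h' used P Q p X q g : two_paths h used P Q ->
  column_moves h h' used p X -> fresh_for h' P Q q ->
  (forall y, y \in X -> y \in P -> y = head 0 P) ->
  (forall y, y \in X -> y \in Q -> y = head 0 Q) ->
  g \in [:: column p; column p + 2 * d] ->
  colored h' red (head 0 P) (v g) -> colored h' red (head 0 Q) (v g) ->
  two_paths h' (p :: used) [:: q] (rev P ++ v g :: Q).
Proof.
case=> vp au altP altQ iP iQ PQ oP oQ sz [vcp pu ev Xoff] [hq qP qQ qoff] XP XQ gt cP cQ.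
have fc := free_column_new au vcp pu; have Uev := @in_columns_even used.
have [UU Ut Ut'] := in_columns_new used p; have [tL t'L _ _ _] := fc.
have PF x : x \in P -> x \notin [:: v (column p); v (column p + 2 * d)] :=
  alternating_notinF vp Uev altP fc.
have QF x : x \in Q -> x \notin [:: v (column p); v (column p + 2 * d)] :=
  alternating_notinF vp Uev altQ fc.
have gL : g < L by move: gt; rewrite !inE => /orP[]/eqP->.
have gF : v g \in [:: v (column p); v (column p + 2 * d)].
  by move: gt; rewrite !inE => /orP[]/eqP->; rewrite eqxx ?orbT.
have ig s : alternating h (in_columns used) s -> ipath h red s ->
    (forall x, x \in s -> x \notin [:: v (column p); v (column p + 2 * d)]) ->
    (forall y, y \in X -> y \in s -> y = head 0 s) ->
    colored h' red (head 0 s) (v g) -> ipath h' red (v g :: s).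
  move=> alts is_ sF Xs cs; apply: ipath_consI; first exact: evolves_ipath ev sF is_.
  - by apply/negP => /sF; rewrite gF.
  - by rewrite colored_sym.
  - move=> k /andP[k0 kN]; have ks : nth 0 s k \in s by apply: mem_nth.
    suff kX : nth 0 s k \notin X by have [] := alternating_nadj vp Uev alts fc ev gt ks kX.
    apply/negP => /Xs /(_ ks) /eqP; rewrite -nth0 nth_uniq ?(ipath_uniq is_) //.
      by rewrite eqn0Ngt k0.
    by apply: leq_ltn_trans kN.
split=> //.
- exact: blue_path_evolves ev Xoff vp.
- by rewrite /= vcp.
- by move=> [|k] kN //=; split=> // j jL; rewrite (negbTE (hq _)).
- have altP' := alternating_evolves vp ev tL t'L UU Ut Ut' altP.
  have altQ' := alternating_evolves vp ev tL t'L UU Ut Ut' altQ.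
  move=> k; rewrite size_cat size_rev /= => kN; rewrite nth_cat size_rev.
  have [kP|kP] := ltnP k (size P).
    by have := alternating_rev oP altP' (k := k); rewrite size_rev; apply.
  have [->|kne] := eqVneq k (size P).
    by rewrite subnn oP; exists g; split=> //; move: gt; rewrite !inE => /orP[]/eqP->.
  have -> : k - size P = (k - (size P).+1).+1 by move: kP kne; clear; lia.
  have := altQ' (k - (size P).+1); rewrite /=.
  have -> : odd (k - (size P).+1) = odd k by move: kP kne oP; clear; lia.
  by apply; move: kN kP kne; clear; lia.
- by apply: ipath_join; [apply: ig|apply: ig|apply: evolves_apart ev PF QF PQ].
- apply: apart_fresh => //; rewrite mem_cat mem_rev in_cons !negb_or qP qQ andbT.
  exact: qoff.
- by rewrite size_cat size_rev /=; move: oP oQ; clear; lia.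
- by rewrite size_cat size_rev /=; move: sz; clear; lia.
Qed.

(** The positions between the two rows of a column stay in its block. So a vertex can be tested on
    any column of a block in which it has no neighbour, and only the number of blocks met
    matters. *)
Definition few_blocks (h : position) (x k : nat) : Prop :=
  exists2 bs : seq nat, size bs <= k &
    forall j, j < L -> drawn h x (v j) -> j %/ (4 * d) \in bs.

Lemma few_blocks_leq h x k k' : k <= k' -> few_blocks h x k -> few_blocks h x k'.
Proof. by move=> kk' [bs bk H]; exists bs => //; apply: leq_trans kk'. Qed.

Lemma few_blocks_keep h h' used p X x k : column_moves h h' used p X ->
  offpath x -> x \notin X -> few_blocks h x k -> few_blocks h' x k.
Proof.
case=> vcp _ ev _ xoff xX [bs bk H]; exists bs => // j jL.
have lt := valid_column_lt vcp.
have xF : x \notin [:: v (column p); v (column p + 2 * d)].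
  by rewrite !inE negb_or !xoff //; move: lt; clear; lia.
by move/(evolves_old ev xX xF); apply: H.
Qed.

Lemma few_blocks_ask h h' used p X x k : blue_path h -> column_moves h h' used p X ->
  offpath x -> few_blocks h x k -> few_blocks h' x k.+1.
Proof.
move=> vp [vcp _ [_ dr] _] xoff [bs bk H]; exists (p.1 :: bs) => // j jL.
have lt := valid_column_lt vcp; have /andP[_ pd] := vcp.
have tL : column p < L by move: lt; clear; lia.
have t'L : column p + 2 * d < L by move: lt; clear; lia.
case/dr=> [/(H _ jL)||].
- by rewrite in_cons => ->; rewrite orbT.
- by rewrite !inE (negbTE (xoff _ tL)) (negbTE (xoff _ t'L)).
rewrite !inE !(v_inj vp) // => /andP[_ jE].
rewrite (@column_block p j) ?eqxx //; move: jE; clear.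
by case/orP=> /eqP->; lia.
Qed.

Lemma few_blocks_fresh h h' used P Q p X z : blue_path h ->
  column_moves h h' used p X -> fresh_for h P Q z -> few_blocks h' z 1.
Proof.
move=> vp cm [hz _ _ zoff]; apply: (few_blocks_ask vp cm zoff).
by exists [::] => // j _; rewrite (negbTE (hz _)).
Qed.

(** Tests reach heads only, so the last vertex keeps its blocks unless the path is a single vertex;
    then the sharper bound on the head leaves room for one more block. *)
Lemma few_blocks_last h h' used p X s k : blue_path h -> column_moves h h' used p X ->
  ipath h red s -> 0 < size s -> k <= 2 -> (forall x, x \in s -> x = last 0 s -> offpath x) ->
  (forall y, y \in X -> y \in s -> y = head 0 s) ->
  few_blocks h (head 0 s) (k - (size s == 1)) -> few_blocks h (last 0 s) 2 ->
  few_blocks h' (last 0 s) 2.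
Proof.
move=> vp cm is_ s0 k2 soff Xs fh fl.
have l_in : last 0 s \in s by rewrite -nth_last; apply: mem_nth; rewrite ltn_predL.
have loff := soff _ l_in erefl.
have [s1|s1] := eqVneq (size s) 1.
  have lh : last 0 s = head 0 s by case: (s) s1 => [|a [|]].
  rewrite s1 in fh; rewrite lh in loff *.
  apply: (@few_blocks_leq _ _ (k - 1).+1); first by move: k2; clear; lia.
  exact: few_blocks_ask vp cm loff fh.
apply: (few_blocks_keep cm loff _ fl); apply/negP => /Xs /(_ l_in) /eqP.
rewrite -nth_last -nth0 nth_uniq ?(ipath_uniq is_) ?ltn_predL //.
by move: s0 s1; clear; lia.
Qed.

(* P is the active path and Q the idle one; they grow at their heads. A vertex
   can be tested on a column if its block contains none of its neighbours, so
   that at most 1 + 2 of the 6 blocks are forbidden by the two heads. After a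
   join the last vertices become heads again; the vertex of a singleton path
   is both head and last, whence the smaller bound for it. *)
Definition invariant (h : position) (used : seq (nat * nat)) (P Q : seq nat) : Prop :=
  [/\ two_paths h used P Q, few_blocks h (head 0 P) (1 - (size P == 1)),
      few_blocks h (last 0 P) 2, few_blocks h (head 0 Q) (2 - (size Q == 1))
    & few_blocks h (last 0 Q) 2].

(** * One column: extending or joining the paths *)

Lemma two_paths_offpath h used P Q : two_paths h used P Q ->
  [/\ offpath (head 0 P), offpath (last 0 P), offpath (head 0 Q) & offpath (last 0 Q)].
Proof.
case=> vp au altP altQ iP iQ PQ oP oQ sz.
have [] := alternating_head (odd_gt0 oP) altP; have [] := alternating_last oP altP.
by have [] := alternating_head (odd_gt0 oQ) altQ; have [] := alternating_last oQ altQ.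
Qed.

Lemma mem_head_odd (s : seq nat) : odd (size s) -> head 0 s \in s.
Proof. by case: s => // a s _; rewrite mem_head. Qed.

Lemma mem_last_odd (s : seq nat) : odd (size s) -> last 0 s \in s.
Proof. by case: s => // a s _; rewrite /= mem_last. Qed.

(** The new head [z] has met one block, and no vertex of Q was tested. *)
Lemma invariant_extend_active h h' used P Q p X z g : invariant h used P Q ->
  column_moves h h' used p X -> fresh_for h P Q z ->
  (forall y, y \in X -> y \in P -> y = head 0 P) ->
  (forall y, y \in X -> y \notin Q) ->
  g \in [:: column p; column p + 2 * d] ->
  colored h' red (head 0 P) (v g) -> colored h' red z (v g) ->
  invariant h' (p :: used) [:: z, v g & P] Q.
Proof.
move=> [tp fhP flP fhQ flQ] cm zf XP XQ gt cP cz.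
have [ohP olP ohQ olQ] := two_paths_offpath tp.
have [vp au altP altQ iP iQ PQ oP oQ sz] := tp.
have hQ := mem_head_odd oQ; have lQ := mem_last_odd oQ.
have hQX : head 0 Q \notin X by apply/negP => /XQ; rewrite hQ.
have lQX : last 0 Q \notin X by apply/negP => /XQ; rewrite lQ.
split.
- apply: (two_paths_extend tp cm zf) => //.
    by move=> y yX yQ; have := XQ y yX; rewrite yQ.
  have [vcp pu ev Xoff] := cm; have fc := free_column_new au vcp pu.
  by have [] := alternating_nadj vp (@in_columns_even used) altQ fc ev gt hQ hQX.
- exact: few_blocks_fresh vp cm zf.
- have -> : last 0 [:: z, v g & P] = last 0 P by case: (P) oP.
  by apply: (few_blocks_last vp cm iP (odd_gt0 oP) _ _ XP fhP flP) => // x _ ->.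
- exact: few_blocks_keep cm ohQ hQX fhQ.
- exact: few_blocks_keep cm olQ lQX flQ.
Qed.

(** The roles swap: the extended Q becomes active, and P becomes idle, where its head may have met
    one block more. *)
Lemma invariant_extend_idle h h' used P Q p X z g : invariant h used P Q ->
  column_moves h h' used p X -> fresh_for h P Q z ->
  (forall y, y \in X -> y \in P -> y = head 0 P) ->
  (forall y, y \in X -> y \in Q -> y = head 0 Q) ->
  g \in [:: column p; column p + 2 * d] ->
  colored h' red (head 0 Q) (v g) -> colored h' red z (v g) ->
  ~~ drawn h' (v g) (head 0 P) ->
  invariant h' (p :: used) [:: z, v g & Q] P.
Proof.
move=> [tp fhP flP fhQ flQ] cm zf XP XQ gt cQ cz nP.
have [ohP olP ohQ olQ] := two_paths_offpath tp.
have [vp au altP altQ iP iQ PQ oP oQ sz] := tp.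
have zf' : fresh_for h Q P z by case: zf.
split.
- exact: (two_paths_extend (two_paths_sym tp) cm zf').
- exact: few_blocks_fresh vp cm zf.
- have -> : last 0 [:: z, v g & Q] = last 0 Q by case: (Q) oQ.
  by apply: (few_blocks_last vp cm iQ (odd_gt0 oQ) _ _ XQ fhQ flQ) => // x _ ->.
- apply: (few_blocks_leq _ (few_blocks_ask vp cm ohP fhP)).
  by case: (size P == 1).
- by apply: (few_blocks_last vp cm iP (odd_gt0 oP) _ _ XP fhP flP) => // x _ ->.
Qed.

(** The active path is now the isolated vertex [q]; the ends of the joined idle path are the former
    last vertices, which have met at most two blocks. *)
Lemma invariant_join h h' used P Q p X q g : invariant h used P Q ->
  column_moves h h' used p X -> fresh_for h' P Q q ->
  (forall y, y \in X -> y \in P -> y = head 0 P) ->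
  (forall y, y \in X -> y \in Q -> y = head 0 Q) ->
  g \in [:: column p; column p + 2 * d] ->
  colored h' red (head 0 P) (v g) -> colored h' red (head 0 Q) (v g) ->
  invariant h' (p :: used) [:: q] (rev P ++ v g :: Q).
Proof.
move=> [tp fhP flP fhQ flQ] cm qf XP XQ gt cP cQ.
have [ohP olP ohQ olQ] := two_paths_offpath tp.
have [vp au altP altQ iP iQ PQ oP oQ sz] := tp.
have f0 : few_blocks h' q 0.
  by case: qf => hq _ _ _; exists [::] => // j _; rewrite (negbTE (hq _)).
split=> //.
- exact: (two_paths_join tp cm qf).
- exact: few_blocks_leq f0.
- have -> : head 0 (rev P ++ v g :: Q) = last 0 P.
    by case/lastP: (P) oP => // s x _; rewrite rev_rcons last_rcons.
  have -> : (size (rev P ++ v g :: Q) == 1) = false.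
    by rewrite size_cat size_rev /=; move: oP oQ; clear; lia.
  by apply: (few_blocks_last vp cm iP (odd_gt0 oP) _ _ XP fhP flP) => // x _ ->.
- have -> : last 0 (rev P ++ v g :: Q) = last 0 Q.
    by rewrite last_cat /=; case: (Q) oQ.
  by apply: (few_blocks_last vp cm iQ (odd_gt0 oQ) _ _ XQ fhQ flQ) => // x _ ->.
Qed.

Lemma column_win h h' used p X y : blue_path h -> column_moves h h' used p X ->
  offpath y -> (forall j, j < L -> drawn h y (v j) -> j %/ (4 * d) != p.1) ->
  colored h' c y (v (column p)) -> colored h' c y (v (column p + 2 * d)) -> G h'.
Proof.
move=> vp [vcp _ ev Xoff] yoff yb c0 c1; have lt := valid_column_lt vcp.
have /andP[_ pd] := vcp.
have tL : column p < L by move: lt; clear; lia.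
have t'L : column p + 2 * d < L by move: lt; clear; lia.
apply: (blue_win (blue_path_evolves ev Xoff vp) t'L yoff _ c0 c1).
move=> j jt; have jL : j < L by move: jt t'L; clear; lia.
apply/negP; case: ev => _ dr /dr[/(yb _ jL)||].
- by rewrite (column_block pd) ?eqxx //; move: jt; clear; lia.
- by rewrite !inE (negbTE (yoff _ tL)) (negbTE (yoff _ t'L)).
- by rewrite !inE !(v_inj vp) //; move: jt; clear; lia.
Qed.

(** Both orders of a column, so that one argument covers a new vertex that is blue to either row. *)
Definition rows (p : nat * nat) (g0 g1 : nat) : Prop :=
  (g0, g1) = (column p, column p + 2 * d) \/ (g0, g1) = (column p + 2 * d, column p).

Definition block_free (h : position) (p : nat * nat) (y : nat) : Prop :=
  forall j, j < L -> drawn h y (v j) -> j %/ (4 * d) != p.1.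

Lemma rows_win h h' used p X y g0 g1 : blue_path h -> column_moves h h' used p X ->
  offpath y -> block_free h p y -> rows p g0 g1 ->
  colored h' c y (v g0) -> colored h' c y (v g1) -> G h'.
Proof.
by move=> vp cm yoff yb [] [-> ->] c0 c1; apply: (column_win vp cm yoff yb).
Qed.

Lemma column_moves_add h h' used p X a g col : column_moves h h' used p X ->
  a \in X -> g \in [:: column p; column p + 2 * d] ->
  column_moves h (add_edge h' a (v g) col) used p X.
Proof.
move=> [vcp pu ev Xoff] aX gt; split=> //; apply: evolves_add ev aX _.
by move: gt; rewrite !inE => /orP[]/eqP->; rewrite eqxx ?orbT.
Qed.

Lemma column_moves_weak h h' used p X X' : {subset X <= X'} ->
  (forall x, x \in X' -> offpath x) -> column_moves h h' used p X ->
  column_moves h h' used p X'.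
Proof. by move=> XX' X'off [vcp pu ev _]; split=> //; apply: evolves_weak ev. Qed.

(* As [z] is blue to row [g0], it is red to row [g1]. If the head of P is blue to
   [g0] as well, they meet at [g1]. Otherwise that head is never tested at [g1],
   where the head of Q may meet [z]; failing this it meets the head of P at [g0]. *)
Lemma rows_step m h used P Q p g0 g1 h1 z X1 : invariant h used P Q ->
  block_free h p (head 0 P) -> block_free h p (head 0 Q) -> rows p g0 g1 ->
  fresh_for h P Q z -> column_moves h h1 used p X1 -> z \in X1 ->
  (forall y, y \in X1 -> y \notin P /\ y \notin Q) ->
  colored h1 c z (v g0) -> ~~ drawn h1 z (v g1) ->
  (forall h' used' P' Q', invariant h' used' P' Q' ->
     size used' = (size used).+1 -> forces m G h') ->
  forces (3 + m) G h1.
Proof.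
move=> inv wb ub rw zf cm zX X1n cz nz next.
have [tp _ _ _ _] := inv; have [vp au altP altQ iP iQ PQ oP oQ sz] := tp.
have [woff _ uoff _] := two_paths_offpath tp.
have [hz zP zQ zoff] := zf.
have wP := mem_head_odd oP; have uQ := mem_head_odd oQ.
set w := head 0 P in woff wP wb *; set u := head 0 Q in uoff uQ ub *.
have wz : w != z by apply: contraNneq zP => <-.
have uz : u != z by apply: contraNneq zQ => <-.
have wu : w != u by apply: (apart_neq PQ).
have wX : w \notin X1 by apply/negP => /X1n[]; rewrite wP.
have uX : u \notin X1 by apply/negP => /X1n[_]; rewrite uQ.
have wQ : w \notin Q := apart_notin PQ wP.
have uP : u \notin P := apart_notinr PQ uQ.
have [vcp pu ev1 X1off] := cm; have fc := free_column_new au vcp pu.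
have [tL t'L te t'e /andP[Ut Ut']] := fc; have Uev := @in_columns_even used.
have [g0t g1t g01 [g0L g1L]] : [/\ g0 \in [:: column p; column p + 2 * d],
    g1 \in [:: column p; column p + 2 * d], v g0 != v g1 & g0 < L /\ g1 < L].
  case: rw => -[-> ->]; rewrite !inE !eqxx !orbT (v_inj vp) //; split=> //;
    by move: d_gt1; clear; lia.
have nw g : g \in [:: column p; column p + 2 * d] -> ~~ drawn h1 w (v g).
  move=> gt; rewrite drawn_sym.
  by have [] := alternating_nadj vp Uev altP fc ev1 gt wP wX.
have nu g : g \in [:: column p; column p + 2 * d] -> ~~ drawn h1 u (v g).
  move=> gt; rewrite drawn_sym.
  by have [] := alternating_nadj vp Uev altQ fc ev1 gt uQ uX.
have zb : block_free h p z by move=> j _; rewrite (negbTE (hz _)).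
have Xwoff x : x \in w :: X1 -> offpath x.
  by rewrite in_cons => /orP[/eqP->//|/X1off].
have Xoff x : x \in [:: w, u & X1] -> offpath x.
  by rewrite !in_cons => /or3P[/eqP->|/eqP->|/X1off].
have cmw : column_moves h h1 used p (w :: X1).
  by apply: column_moves_weak cm => // x xX; rewrite in_cons xX orbT.
have cmu : column_moves h h1 used p [:: w, u & X1].
  by apply: column_moves_weak cm => // x xX; rewrite !in_cons xX !orbT.
have XP y : y \in [:: w, u & X1] -> y \in P -> y = w.
  rewrite !in_cons => /or3P[/eqP->//|/eqP->|/X1n[/negbTE->//]].
  by rewrite (negbTE uP).
have XQ y : y \in [:: w, u & X1] -> y \in Q -> y = u.
  rewrite !in_cons => /or3P[/eqP->|/eqP->//|/X1n[_ /negbTE->//]].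
  by rewrite (negbTE wQ).
have [wi ui] : w \in [:: w, u & X1] /\ u \in [:: w, u & X1].
  by rewrite !in_cons !eqxx orbT.
have zi : z \in [:: w, u & X1] by rewrite !in_cons zX !orbT.
have [wiw ziw] : w \in w :: X1 /\ z \in w :: X1 by rewrite !in_cons eqxx zX orbT.
have offE x g : offpath x -> g < L -> (x == v g) = false.
  by move=> xoff gL; apply/negbTE/xoff.
have [g10 zw] : v g1 != v g0 /\ z != w by rewrite eq_sym g01 eq_sym wz.
have [zu uw] : z != u /\ u != w by rewrite eq_sym uz eq_sym wu.
have E := (drawn_add, offE w g0 woff g0L, offE w g1 woff g1L, offE u g0 uoff g0L,
  offE u g1 uoff g1L, offE z g0 zoff g0L, offE z g1 zoff g1L, negbTE wz, negbTE uz,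
  negbTE wu, negbTE zw, negbTE zu, negbTE uw, negbTE g01, negbTE g10,
  andbF, andFb, orbF).
(* If [w] is blue to [g0], then [w] and [z] must both be red to [g1], where P is extended. *)
apply: (@forces_draw_color c _ _ _ w (v g0)); [exact: woff|exact: nw| |].
- apply: (@forces_draw_color c _ _ _ w (v g1)); [exact: woff|by rewrite !E nw| |].
  + apply: forces_now; apply: (rows_win (used := used) (X := w :: X1) vp _ woff wb rw).
    * by do 2![apply: column_moves_add => //]; apply: cmw.
    * by rewrite colored_add colored_add_new.
    * exact: colored_add_new.
  apply: (@forces_draw_color c _ _ _ z (v g1)); first exact: zoff.
  + by rewrite !E.
  + apply: forces_now; apply: (rows_win (used := used) (X := w :: X1) vp _ zoff zb rw).
    * by do 3![apply: column_moves_add => //]; apply: cmw.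
    * by rewrite !colored_add cz.
    * exact: colored_add_new.
  apply: (next _ (p :: used) [:: z, v g1 & P] Q) => //.
  apply: (invariant_extend_active inv (X := w :: X1)) => //.
  + by do 3![apply: column_moves_add => //]; apply: cmw.
  + by move=> y yX; apply: XP; move: yX; rewrite !in_cons => /orP[]->; rewrite ?orbT.
  + by move=> y; rewrite in_cons => /orP[/eqP->|/X1n[]].
  + by rewrite colored_add colored_add_new.
  + exact: colored_add_new.
(* Now [w] is red to [g0]. If [u] is blue to [g1], it must be red to [g0], where the paths join; if
   it is red to [g1], so must be [z], and Q is extended. *)
apply: (@forces_draw_color c _ _ _ u (v g1)); first exact: uoff.
- by rewrite !E nu.
- apply: (@forces_draw_color c _ _ _ u (v g0)); first exact: uoff.
  + by rewrite !E nu.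
  + apply: forces_now; apply: (rows_win (used := used) (X := [:: w, u & X1]) vp _ uoff ub rw).
    * by do 3![apply: column_moves_add => //]; apply: cmu.
    * exact: colored_add_new.
    * by rewrite colored_add colored_add_new.
  set h4 := add_edge _ _ _ _.
  have [q qn hq] := fresh_vertex h4 (P ++ Q ++ [seq v i | i <- iota 0 L]).
  move: qn; rewrite !mem_cat !negb_or => /and3P[qP qQ qv].
  apply: (next _ (p :: used) [:: q] (rev P ++ v g0 :: Q)) => //.
  apply: (invariant_join inv (X := [:: w, u & X1])) => //.
  + by do 3![apply: column_moves_add => //]; apply: cmu.
  + split=> // j jL; apply: contraNneq qv => ->; apply/mapP; exists j => //.
    by rewrite mem_iota.
  + by rewrite /h4 !colored_add !eqxx !orbT.
  + exact: colored_add_new.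
apply: (@forces_draw_color c _ _ _ z (v g1)); first exact: zoff.
- by rewrite !E.
- apply: forces_now; apply: (rows_win (used := used) (X := [:: w, u & X1]) vp _ zoff zb rw).
  + by do 3![apply: column_moves_add => //]; apply: cmu.
  + by rewrite !colored_add cz.
  + exact: colored_add_new.
apply: (next _ (p :: used) [:: z, v g1 & Q] P) => //.
apply: (invariant_extend_idle inv (X := [:: w, u & X1])) => //.
- by do 3![apply: column_moves_add => //]; apply: cmu.
- by rewrite colored_add colored_add_new.
- exact: colored_add_new.
- by rewrite drawn_sym !E nw.
Qed.

(** At least three of the six blocks remain, with d columns each, and fewer than 3d columns are
    used. *)
Lemma column_choice (used : seq (nat * nat)) (bs : seq nat) :
  size bs <= 3 -> size used < 3 * d ->
  exists p, [/\ valid_column p, p \notin used & p.1 \notin bs].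
Proof.
move=> bs3 used3; pose ok := [seq b <- iota 0 6 | b \notin bs].
have ok3 : 3 <= size ok.
  have le : size [seq b <- iota 0 6 | b \in bs] <= size bs.
    apply: uniq_leq_size; first by rewrite filter_uniq // iota_uniq.
    by move=> b; rewrite mem_filter => /andP[].
  have E : size [seq b <- iota 0 6 | b \in bs] + size ok = 6.
    by rewrite !size_filter; apply: (count_predC (fun b => b \in bs) (iota 0 6)).
  by move: le bs3 E; clear; lia.
pose cands := [seq (b, i) | b <- ok, i <- iota 0 d].
have uc : uniq cands.
  apply: allpairs_uniq; rewrite ?filter_uniq ?iota_uniq //.
  by move=> [a b] [a' b'] _ _ /= [-> ->].
have [/allP sub|] := boolP (all (mem used) cands).
  have := uniq_leq_size uc sub; rewrite size_allpairs size_iota => le.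
  have le3 : 3 * d <= size ok * d by rewrite leq_mul2r ok3 orbT.
  by have := leq_ltn_trans (leq_trans le3 le) used3; rewrite ltnn.
case/allPn=> p /allpairsP[[b i] /= [b_ok i_d ->]] pu; exists (b, i).
move: b_ok i_d; rewrite mem_filter !mem_iota /valid_column /= => /andP[-> ->] ->.
by split.
Qed.

(** Two new vertices are tested on opposite rows. If one is blue, [rows_step] takes it as its [z],
    after at most two rounds. If both are red, the head of P must be red to some row and is extended
    by the new vertex there. *)
Lemma column_step m h used P Q : invariant h used P Q -> size used < 3 * d ->
  (forall h' used' P' Q', invariant h' used' P' Q' ->
     size used' = (size used).+1 -> forces m G h') ->
  forces (5 + m) G h.
Proof.
move=> inv used3 next; have [tp [bw bw1 wb] _ [bu bu2 ub] _] := inv.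
have [vp au altP altQ iP iQ PQ oP oQ sz] := tp.
have [woff _ uoff _] := two_paths_offpath tp.
have [|p [vcp pu pb]] := @column_choice used (bw ++ bu) _ used3.
  by rewrite size_cat; move: bw1 bu2; clear; case: (_ == 1); case: (_ == 1); lia.
have wb' : block_free h p (head 0 P).
  by move=> j jL /(wb _ jL) jb; apply: contraNneq pb => <-; rewrite mem_cat jb.
have ub' : block_free h p (head 0 Q).
  by move=> j jL /(ub _ jL) jb; apply: contraNneq pb => <-; rewrite mem_cat jb orbT.
have fc := free_column_new au vcp pu; have [tL t'L te t'e /andP[Ut Ut']] := fc.
have Uev := @in_columns_even used.
pose V := [seq v i | i <- iota 0 L].
have offV y : y \notin V -> offpath y.
  by move=> yV j jL; apply: contraNneq yV => ->; apply/mapP; exists j; rewrite ?mem_iota.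
have [z zn hz] := fresh_vertex h (P ++ Q ++ V).
have [z' z'n hz'] := fresh_vertex h (z :: P ++ Q ++ V).
move: zn z'n; rewrite !(mem_cat, in_cons) !negb_or => /and3P[zP zQ /offV zoff].
case/and4P=> z'z z'P z'Q /offV z'off.
have zf : fresh_for h P Q z by [].
have zf' : fresh_for h P Q z' by [].
have wP := mem_head_odd oP.
set w := head 0 P in woff wP *.
have wQ : w \notin Q := apart_notin PQ wP.
have wz : w != z by apply: contraNneq zP => <-.
have wz' : w != z' by apply: contraNneq z'P => <-.
have tt' : v (column p) != v (column p + 2 * d).
  by rewrite (v_inj vp) //; move: d_gt1; clear; lia.
have t't : v (column p + 2 * d) != v (column p) by rewrite eq_sym.
have [t_in t'_in] : column p \in [:: column p; column p + 2 * d] /\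
    column p + 2 * d \in [:: column p; column p + 2 * d].
  by rewrite !inE !eqxx orbT.
have cm0 X : (forall x, x \in X -> offpath x) -> column_moves h h used p X.
  by move=> Xoff; split=> //; apply: evolves_refl.
have off1 x : x \in [:: z] -> offpath x by rewrite inE => /eqP->.
have off2 x : x \in [:: z; z'] -> offpath x by rewrite !inE => /orP[]/eqP->.
have off3 x : x \in [:: w; z; z'] -> offpath x by rewrite !inE => /or3P[]/eqP->.
have nw g : g \in [:: column p; column p + 2 * d] -> ~~ drawn h w (v g).
  move=> gt; rewrite drawn_sym.
  by have [] := alternating_nadj vp Uev altP fc (evolves_refl h [::] _) gt wP isT.
apply: (@forces_draw_color c _ _ _ z (v (column p))); [exact: zoff|exact: hz| |].
  apply: (@forces_leq (3 + m)); first by clear; lia.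
  apply: (rows_step (z := z) (X1 := [:: z]) inv wb' ub' _ zf) => //.
  - by left.
  - by apply: column_moves_add => //; [apply: cm0|rewrite inE].
  - by rewrite inE.
  - by move=> y; rewrite inE => /eqP->.
  - exact: colored_add_new.
  - by rewrite drawn_add (negbTE (hz _)) (negbTE (zoff _ tL)) eq_sym (negbTE tt') andbF.
apply: (@forces_draw_color c _ _ _ z' (v (column p + 2 * d))); first exact: z'off.
- by rewrite drawn_add (negbTE (hz' _)) (negbTE z'z) (negbTE (z'off _ tL)).
- apply: (rows_step (z := z') (X1 := [:: z; z']) inv wb' ub' _ zf') => //.
  + by right.
  + do 2![apply: column_moves_add => //; last by rewrite !inE eqxx ?orbT].
    exact: cm0.
  + by rewrite !inE eqxx orbT.
  + by move=> y; rewrite !inE => /orP[]/eqP->.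
  + exact: colored_add_new.
  + rewrite !drawn_add (negbTE (hz' _)) (negbTE z'z) (negbTE (z'off _ tL)).
    by rewrite (negbTE (z'off _ t'L)) (negbTE tt') andbF.
have XP y : y \in [:: w; z; z'] -> y \in P -> y = head 0 P.
  by rewrite !inE => /or3P[]/eqP-> //; rewrite ?(negbTE zP) ?(negbTE z'P).
have XQ y : y \in [:: w; z; z'] -> y \notin Q.
  by rewrite !inE => /or3P[]/eqP->.
have [w_in [z_in z'_in]] : w \in [:: w; z; z'] /\ z \in [:: w; z; z'] /\ z' \in [:: w; z; z'].
  by rewrite !inE !eqxx !orbT.
apply: (@forces_draw_color c _ _ _ w (v (column p))); first exact: woff.
- by rewrite !drawn_add (negbTE (nw _ t_in)) (negbTE wz) (negbTE wz')
    (negbTE (woff _ tL)) (negbTE (woff _ t'L)).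
- apply: (@forces_draw_color c _ _ _ w (v (column p + 2 * d))); first exact: woff.
  + by rewrite !drawn_add (negbTE (nw _ t'_in)) (negbTE wz) (negbTE wz')
      (negbTE (woff _ tL)) (negbTE (woff _ t'L)) (negbTE t't) !andbF.
  + apply: forces_now; apply: (column_win (used := used) (X := [:: w; z; z']) vp _ woff wb').
    * by do 4![apply: column_moves_add => //]; apply: cm0.
    * by rewrite colored_add colored_add_new.
    * exact: colored_add_new.
  apply: (@forces_leq m); first by clear; lia.
  apply: (next _ (p :: used) [:: z', v (column p + 2 * d) & P] Q) => //.
  apply: (invariant_extend_active inv (X := [:: w; z; z'])) => //.
  + by do 4![apply: column_moves_add => //]; apply: cm0.
  + exact: colored_add_new.
  + by rewrite !colored_add !eqxx !orbT.
apply: (@forces_leq m); first by clear; lia.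
apply: (next _ (p :: used) [:: z, v (column p) & P] Q) => //.
apply: (invariant_extend_active inv (X := [:: w; z; z'])) => //.
- by do 3![apply: column_moves_add => //]; apply: cm0.
- exact: colored_add_new.
- by rewrite !colored_add !eqxx !orbT.
Qed.

(** * Counting columns and rounds *)

Lemma alternating_take h U s k : alternating h U s -> alternating h U (take k s).
Proof.
move=> alt i; rewrite size_take_min leq_min => /andP[ik iN].
by rewrite nth_take //; apply: alt.
Qed.

Lemma alternating_drop h U s k : ~~ odd k -> alternating h U s ->
  alternating h U (drop k s).
Proof.
move=> ke alt i; rewrite size_drop nth_drop => iN.
have kiN : k + i < size s by lia.
by have := alt _ kiN; rewrite oddD (negbTE ke).
Qed.

(** As 4d + 3 = (2d + 1) + 1 + (2d + 1), the vertex at index 2d + 1 is dropped; the second piece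
    starts at an even index and alternates again. *)
Lemma red_pair_split h U P : alternating h U P -> ipath h red P ->
  4 * d + 3 <= size P -> exists A B, red_pair h U A B.
Proof.
move=> altP iP sP; exists (take (2 * d + 1) P), (take (2 * d + 1) (drop (2 * d + 2) P)).
have cutP : take (2 * d + 1) P ++ nth 0 P (2 * d + 1) :: drop (2 * d + 2) P = P.
  have lt : 2 * d + 1 < size P by move: sP; clear; lia.
  by rewrite -[RHS](cat_take_drop (2 * d + 1)) [in RHS](drop_nth 0 lt) -addnS.
have sub : {subset take (2 * d + 1) (drop (2 * d + 2) P) <= drop (2 * d + 2) P}.
  by move=> x /mem_take.
split.
- exact: alternating_take.
- by apply/alternating_take/alternating_drop => //; clear; lia.
- by rewrite !size_takel ?size_drop; move: sP; clear; lia.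
- split; first by apply: (@ipath_catl _ _ _ (drop (2 * d + 1) P)); rewrite cat_take_drop.
  apply: (@ipath_catl _ _ _ (drop (2 * d + 1) (drop (2 * d + 2) P))).
  by rewrite cat_take_drop; apply: (@ipath_catr _ _ (take (2 * d + 2) P)); rewrite cat_take_drop.
- have AB := iP; rewrite -cutP in AB.
  by apply: apart_sub sub (ipath_split AB).
Qed.

(** The sizes are odd with sum at least 6d + 2: if one is below 2d + 1, it is at most 2d - 1, and
    the other is at least 4d + 3. *)
Lemma two_paths_red_pair h used P Q : two_paths h used P Q -> 3 * d <= size used ->
  exists A B, red_pair h (in_columns used) A B.
Proof.
case=> vp au altP altQ iP iQ PQ oP oQ sz s3.
have [PQd|[P4|Q4]] : (2 * d + 1 <= size P /\ 2 * d + 1 <= size Q) \/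
    (4 * d + 3 <= size P \/ 4 * d + 3 <= size Q).
- by move: oP oQ sz s3; clear; lia.
- exists (take (2 * d + 1) P), (take (2 * d + 1) Q); case: PQd => sP sQ; split.
  + exact: alternating_take.
  + exact: alternating_take.
  + by rewrite !size_takel.
  + split; first by apply: (@ipath_catl _ _ _ (drop (2 * d + 1) P)); rewrite cat_take_drop.
    by apply: (@ipath_catl _ _ _ (drop (2 * d + 1) Q)); rewrite cat_take_drop.
  + by apply: apart_sub PQ => x /mem_take.
- exact: red_pair_split altP iP P4.
- exact: red_pair_split altQ iQ Q4.
Qed.

(** Here [i] bounds the number of columns missing from 3d; each costs at most 5 rounds, and the
    closing 12. *)
Lemma columns_win i h used P Q : invariant h used P Q -> 3 * d <= size used + i ->
  forces (5 * i + 12) G h.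
Proof.
elim: i h used P Q => [|i IH] h used P Q inv le.
  have [tp _ _ _ _] := inv; have [|A [B pair]] := two_paths_red_pair tp.
    by rewrite addn0 in le.
  have [vp au _ _ _ _ _ _ _ _] := tp.
  exact: closing vp (@in_columns_even used) (fun j => in_columns_lt au) pair.
have [lt|ge] := ltnP (size used) (3 * d); last first.
  by apply: forces_leq (IH _ _ _ _ inv _); [clear; lia|rewrite (leq_trans ge) ?leq_addr].
rewrite mulnS -addnA; apply: (column_step inv lt) => h' used' P' Q' inv' su.
by apply: IH inv' _; rewrite su addSnnS.
Qed.

Lemma blue_path_win h : blue_path h -> forces (15 * d + 12) G h.
Proof.
move=> vp; pose V := [seq v i | i <- iota 0 L].
have offV y : y \notin V -> offpath y.
  by move=> yV j jL; apply: contraNneq yV => ->; apply/mapP; exists j; rewrite ?mem_iota.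
have [z zn hz] := fresh_vertex h V; have [y yn hy] := fresh_vertex h (z :: V).
move: yn; rewrite in_cons negb_or => /andP[yz /offV yoff]; have zoff := offV _ zn.
have -> : 15 * d + 12 = 5 * (3 * d) + 12 by clear; lia.
apply: (@columns_win _ h [::] [:: z] [:: y]) => //.
have few0 x k : (forall a, ~~ drawn h x a) -> few_blocks h x k.
  by move=> hx; exists [::] => // j _; rewrite (negbTE (hx _)).
split; try exact: few0.
split=> //.
- by move=> [|k] //= _; split=> // j _; rewrite (negbTE (hz _)).
- by move=> [|k] //= _; split=> // j _; rewrite (negbTE (hy _)).
- by apply: apart_fresh => //; rewrite inE eq_sym.
Qed.

End EvenCycle.

(** Since [uphalf (252 * d + 27)] is 126d + 14, the long path costs 630d + 70 rounds; the cycle then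
    costs 15d + 12. *)
Lemma forces_even_cycle d : 1 < d -> ~~ odd d ->
  forces (645 * d + 82) (mono_induced_copy (cycle_graph (2 * d + 2))) [::].
Proof.
move=> d1 de; apply: forces_loopless => //.
apply: (@forces_leq (5 * uphalf (9 * (28 * d + 3)) + (15 * d + 12))); first by lia.
apply: forces_path => [|h c s ss is_]; first by lia.
apply: (@blue_path_win d (nth 0 s) c) => // i j.
by rewrite -ss; move/ipathP: is_; apply.
Qed.

Theorem theorem4 (n : nat) (n_ge3 : (3 <= n)%N) (n_odd : odd n) :
  (r_ind (cycle_graph n) <= r_ind (cycle_graph (2 * n)) + (n%:Z)%:E)%E /\
  (r_ind (cycle_graph (2 * n)) + (n%:Z)%:E <= (735%:Z * n%:Z - 27%:Z)%R%:E)%E.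
Proof.
split.
  (* An infinite number for C_2n makes the bound trivial; otherwise an optimal strategy for C_2n is
     followed by the n chords. *)
  have [->|[m -> Gm]] := r_ind_forces (cycle_graph (2 * n)).
    by rewrite addye // leey.
  rewrite -EFinD -PoszD; apply: r_ind_le_forces.
  exact: forces_bind Gm (fun h => @mono_copy_half n h n_ge3 n_odd).
(* With d = n - 1 the length 2d + 2 is 2n, and 645(n - 1) + 82 + n = 646n - 563 is at most 735n -
   27. *)
have d1 : 1 < n.-1 by lia.
have de : ~~ odd n.-1 by lia.
have := r_ind_le_forces (forces_even_cycle d1 de).
have -> : 2 * n.-1 + 2 = 2 * n by lia.
case: (r_ind _) => [r|//|_]; last by rewrite addNye leNye.
by rewrite -EFinD !lee_fin; lia.
Qed.
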